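(* Let $p_1,p_2\ge 3$ be integers and let $a^0,a^1,b^0,b^1:\mathbb{Z}^2\to\mathbb{C}$ be sequences, $(n,m)\mapsto a^j_{nm},b^j_{nm}$, that are $(p_1,p_2)$-periodic, i.e. $a^j_{n+p_1,m}=a^j_{n,m+p_2}=a^j_{nm}$ and likewise for $b^j$ ($j=0,1$), with $b^1_{nm}\in\mathbb{R}$ for all $(n,m)$. Let $\mathcal{J}$ be the $2D$ periodic Jacobi operator on $\ell^2(\mathbb{Z}\times\mathbb{Z})$ described in the context, let $J(x,y)$, $J_0$, $C$ be the matrices described in the context, let $\lambda_1(x,y)\le\dots\le\lambda_{p_1p_2}(x,y)$ be the eigenvalues of $J(x,y)$, and let $\lambda^-_1\le\dots\le\lambda^-_{p_1p_2}$ and $\lambda^+_1\le\dots\le\lambda^+_{p_1p_2}$ be the eigenvalues of $J_0-C$ and $J_0+C$ respectively. Then: (i) $\lambda_n^-\le\lambda_n(x,y)\le\lambda_n^+$ for all $n\in\{1,\dots,p_1p_2\}$ and all $(x,y)\in[0,2\pi]^2$ (the numbers $\lambda_n^\pm$ do not depend on $(x,y)$); (ii) the Lebesgue measure of the spectrum of $\mathcal{J}$ satisfies $$\operatorname{mes}(\sigma(\mathcal{J}))\le\min_{(\alpha,\beta)\in\mathbb{Z}^2} r_{\alpha,\beta},$$ where $$r_{\alpha,\beta}=4\sum_{n=1}^{p_1}|b^0_{n\beta}|+8\sum_{n=1}^{p_1}|a^0_{n\beta}|-8|a^0_{\alpha\beta}|+8\sum_{m=1}^{p_2}|a^0_{\alpha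 m}|+4\sum_{m=1}^{p_2}|a^1_{\alpha m}|.$$
   Context: Operator: identify $f\in\ell^2(\mathbb{Z}\times\mathbb{Z})$ with $f=(f_n)_{n\in\mathbb{Z}}$, $f_n\in\ell^2(\mathbb{Z})$. Set $(\mathcal{J}f)_n=A_nf_{n+1}+B_nf_n+A_{n-1}^*f_{n-1}$, where $A_n=SA^0_n+A^1_n+(SA^0_n)^*$, $B_n=SB^0_n+B^1_n+(SB^0_n)^*$, $A^j_n=\mathrm{diag}(a^j_{nm})_{m\in\mathbb{Z}}$, $B^j_n=\mathrm{diag}(b^j_{nm})_{m\in\mathbb{Z}}$, and $S$ is the shift $(Sz)_m=z_{m-1}$ on $\ell^2(\mathbb{Z})$. Thus $(A_nz)_m=a^0_{n,m-1}z_{m-1}+a^1_{nm}z_m+\overline{a^0_{nm}}z_{m+1}$, similarly for $B_n$; $\mathcal{J}$ is bounded and self-adjoint. Matrices: for $x\in[0,2\pi]$ and $n\in\mathbb{Z}$ let $\hat A_n(x)$ be the $p_2\times p_2$ matrix with diagonal entries $(\hat A_n)_{mm}=a^1_{nm}$, subdiagonal entries $(\hat A_n)_{m+1,m}=a^0_{nm}$, superdiagonal entries $(\hat A_n)_{m,m+1}=\overline{a^0_{nm}}$ ($1\le m\le p_2-1$), corner entries $(\hat A_n)_{1,p_2}=e^{ix}a^0_{np_2}$, $(\hat A_n)_{p_2,1}=e^{-ix}\overline{a^0_{np_2}}$, all other entries $0$. Define $\hat B_n(x)$ in the same way with $a^1,a^0$ replaced by $b^1,b^0$. Let $\hat A_n^0,\hat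 B_n^0$ be $\hat A_n,\hat B_n$ with the two corner entries $(1,p_2)$ and $(p_2,1)$ replaced by $0$ (they do not depend on $x$). $J(x,y)$, $(x,y)\in[0,2\pi]^2$, is the $p_1p_2\times p_1p_2$ Hermitian matrix written as a $p_1\times p_1$ block matrix with $p_2\times p_2$ blocks: diagonal blocks $\hat B_n(x)$ ($1\le n\le p_1$); block $(n+1,n)$ equal to $\hat A_n(x)$ and block $(n,n+1)$ equal to $\hat A_n(x)^*$ ($1\le n\le p_1-1$); block $(1,p_1)$ equal to $e^{iy}\hat A_{p_1}(x)$ and block $(p_1,1)$ equal to $e^{-iy}\hat A_{p_1}(x)^*$; all other blocks zero. $J_0$ is the $p_1\times p_1$ block matrix with diagonal blocks $\hat B^0_n$, block $(n+1,n)=\hat A^0_n$, block $(n,n+1)=(\hat A^0_n)^*$ ($1\le n\le p_1-1$), all other blocks zero. $C=\mathrm{diag}(C_1,\dots,C_{p_1})$ (block diagonal, $p_2\times p_2$ blocks), where for $2\le n\le p_1-1$, $C_n=\mathrm{diag}(c_n,0,\dots,0,c_n)$ with $c_n=|b^0_{np_2}|+|a^0_{np_2}|+|a^0_{n-1,p_2}|$; $C_1=\mathrm{diag}(e_1,0,\dots,0,e_1)+D$ with $e_1=|b^0_{1p_2}|+|a^0_{1p_2}|$; $C_{p_1}=\mathrm{diag}(e_{p_1},0,\dots,0,e_{p_1})+D$ with $e_{p_1}=|b^0_{p_1p_2}|+|a^0_{p_1-1,p_2}|$; and $D=\mathrm{diag}(d_1,\dots,d_{p_2})$ with $d_m=|a^1_{p_1m}|+|a^0_{p_1m}|+|a^0_{p_1,m-1}|$,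 where $a^0_{p_1,0}:=a^0_{p_1,p_2}$. *)

(* Defs.v *)
From HB Require Import structures.
From mathcomp Require Import all_boot all_order all_algebra.
From mathcomp Require Import all_classical all_reals all_analysis.
From mathcomp Require Import complex.
Set Implicit Arguments. Unset Strict Implicit. Unset Printing Implicit Defensive.
Import Order.TTheory GRing.Theory Num.Theory.
Local Open Scope ring_scope.
Local Open Scope complex_scope.

Section Defs.
Variable R : realType.
Local Notation C := R[i].

Definition cnorm2 (z : C) : R := (complex.Re z) ^+ 2 + (complex.Im z) ^+ 2.
Definition cabs (z : C) : R := Num.sqrt (cnorm2 z).

Definition expi (x : R) : C := (cos x) +i* (sin x).

Definition periodic2 (p1 p2 : nat) (c : int -> int -> C) : Prop :=
  forall n m : int, c (n + p1%:Z)%R m = c n m /\ c n (m + p2%:Z)%R = c n m.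

(* (T z)_m = c_{n,m-1} z_{m-1} + d_{nm} z_m + conj(c_{nm}) z_{m+1}, i.e.
   T = S C^0_n + D^1_n + (S C^0_n)^*  with C^0_n = diag(c_{nm}), D^1_n = diag(d_{nm}) *)
Definition tri_op (c d : int -> int -> C) (n : int) (z : int -> C) : int -> C :=
  fun m => c n (m - 1) * z (m - 1) + d n m * z m + (c n m)^* * z (m + 1).

Definition tri_op_adj (c d : int -> int -> C) (n : int) (z : int -> C) : int -> C :=
  fun m => c n (m - 1) * z (m - 1) + (d n m)^* * z m + (c n m)^* * z (m + 1).

Definition Jop (a0 a1 b0 b1 : int -> int -> C) (f : int -> int -> C) : int -> int -> C :=
  fun n m => tri_op a0 a1 n (f (n + 1)) m + tri_op b0 b1 n (f n) m
             + tri_op_adj a0 a1 (n - 1) (f (n - 1)) m.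

Definition l2 (f : int -> int -> C) : Prop :=
  (\esum_(k in [set: int * int]) (cnorm2 (f k.1 k.2))%:E < +oo)%E.

(* spectrum of J (a self-adjoint bounded operator, so a subset of R):
   the real l such that J - l is not a bijection of l^2 onto itself *)
Definition spectrum (a0 a1 b0 b1 : int -> int -> C) : set R :=
  [set l : R | ~ (forall g, l2 g ->
      exists! f, l2 f /\ (fun n m => Jop a0 a1 b0 b1 f n m - l%:C * f n m) = g)].

(* entries (0-based indices i j < p2; paper index m = i+1) of \hat A_n(x)
   built from (c,d) = (a^0,a^1) or (b^0,b^1) *)
Definition hat_e (p2 : nat) (c d : int -> int -> C) (n : int) (x : R) (i j : nat) : C :=
  if i == j then d n (i.+1)%:Z
  else if i == j.+1 then c n (j.+1)%:Z
  else if j == i.+1 then (c n (i.+1)%:Z)^*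
  else if (i == 0%N) && (j == p2.-1) then expi x * c n p2%:Z
  else if (i == p2.-1) && (j == 0%N) then (expi x)^* * (c n p2%:Z)^*
  else 0.

Definition hat0_e (c d : int -> int -> C) (n : int) (i j : nat) : C :=
  if i == j then d n (i.+1)%:Z
  else if i == j.+1 then c n (j.+1)%:Z
  else if j == i.+1 then (c n (i.+1)%:Z)^*
  else 0.

Definition hatA (p2 : nat) (c d : int -> int -> C) (n : int) (x : R) : 'M[C]_p2 :=
  \matrix_(i < p2, j < p2) hat_e p2 c d n x i j.

(* J(x,y): p1 x p1 block matrix with p2 x p2 blocks; row index i corresponds to
   block N = i %/ p2 (paper n = N+1) and inner index i %% p2 (paper m = i%%p2 + 1) *)
Definition Jmat (p1 p2 : nat) (a0 a1 b0 b1 : int -> int -> C) (x y : R)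
  : 'M[C]_(p1 * p2) :=
  \matrix_(i, j)
    let N := (i %/ p2)%N in let K := (j %/ p2)%N in
    let u := (i %% p2)%N in let v := (j %% p2)%N in
    if N == K then hat_e p2 b0 b1 (N.+1)%:Z x u v
    else if N == K.+1 then hat_e p2 a0 a1 (K.+1)%:Z x u v
    else if K == N.+1 then (hat_e p2 a0 a1 (N.+1)%:Z x v u)^*
    else if (N == 0%N) && (K == p1.-1) then expi y * hat_e p2 a0 a1 p1%:Z x u v
    else if (N == p1.-1) && (K == 0%N) then (expi y)^* * (hat_e p2 a0 a1 p1%:Z x v u)^*
    else 0.

Definition J0mat (p1 p2 : nat) (a0 a1 b0 b1 : int -> int -> C) : 'M[C]_(p1 * p2) :=
  \matrix_(i, j)
    let N := (i %/ p2)%N in let K := (j %/ p2)%N in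
    let u := (i %% p2)%N in let v := (j %% p2)%N in
    if N == K then hat0_e b0 b1 (N.+1)%:Z u v
    else if N == K.+1 then hat0_e a0 a1 (K.+1)%:Z u v
    else if K == N.+1 then (hat0_e a0 a1 (N.+1)%:Z v u)^*
    else 0.

(* d_m, with the convention a^0_{p1,0} := a^0_{p1,p2} *)
Definition dcoef (p1 p2 : nat) (a0 a1 : int -> int -> C) (m : nat) : R :=
  cabs (a1 p1%:Z m%:Z) + cabs (a0 p1%:Z m%:Z)
  + cabs (if m == 1%N then a0 p1%:Z p2%:Z else a0 p1%:Z (m.-1)%:Z).

(* diagonal entry of block C_n (paper n = N+1) at inner position u (paper m = u+1) *)
Definition ccoef (p1 p2 : nat) (a0 a1 b0 b1 : int -> int -> C) (N u : nat) : R :=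
  let n := N.+1 in
  let edge := (u == 0%N) || (u == p2.-1) in
  if n == 1%N then
    (if edge then cabs (b0 1 p2%:Z) + cabs (a0 1 p2%:Z) else 0)
    + dcoef p1 p2 a0 a1 u.+1
  else if n == p1 then
    (if edge then cabs (b0 p1%:Z p2%:Z) + cabs (a0 (p1.-1)%:Z p2%:Z) else 0)
    + dcoef p1 p2 a0 a1 u.+1
  else
    (if edge then cabs (b0 n%:Z p2%:Z) + cabs (a0 n%:Z p2%:Z) + cabs (a0 (n.-1)%:Z p2%:Z)
     else 0).

Definition Cmat (p1 p2 : nat) (a0 a1 b0 b1 : int -> int -> C) : 'M[C]_(p1 * p2) :=
  \matrix_(i, j)
    if i == j then (ccoef p1 p2 a0 a1 b0 b1 (i %/ p2) (i %% p2))%:C else 0.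

Definition sorted_eigs (N : nat) (A : 'M[C]_N) (s : seq R) : Prop :=
  sorted <=%R s /\ char_poly A = \prod_(r <- s) ('X - (r%:C)%:P).

Definition rbound (p1 p2 : nat) (a0 a1 b0 : int -> int -> C) (al be : int) : R :=
  4 * (\sum_(1 <= n < p1.+1) cabs (b0 n%:Z be))
  + 8 * (\sum_(1 <= n < p1.+1) cabs (a0 n%:Z be))
  - 8 * cabs (a0 al be)
  + 8 * (\sum_(1 <= m < p2.+1) cabs (a0 al m%:Z))
  + 4 * (\sum_(1 <= m < p2.+1) cabs (a1 al m%:Z)).

End Defs.

(* Main.v *)
Require Import Defs.
From HB Require Import structures.
From mathcomp Require Import all_boot all_order all_algebra.
From mathcomp Require Import all_classical all_reals all_analysis.
From mathcomp Require Import complex.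
From mathcomp Require Import ring lra zify.
From mathcomp Require Import perm spectral sesquilinear.
Import Order.TTheory GRing.Theory Num.Theory.
Local Open Scope ring_scope.
Local Open Scope complex_scope.
Set Implicit Arguments. Unset Strict Implicit. Unset Printing Implicit Defensive.

(* A Hermitian matrix whose absolute column sums are at most [w] lies between [-diag w]
   and [diag w] as a quadratic form. Applied to [J(x,y) - J_0], this gives
   [J_0 - C <= J(x,y) <= J_0 + C], hence (i) by Weyl's monotonicity.

   For (ii), cut the lattice into translates of the
   cell [{al+1..al+p1} x {be+1..be+p2}]; on l^2 the operator lies between the direct sums
   of the cell matrices [M_0 - W] and [M_0 + W], where the diagonal matrix [W] collects
   the moduli of the coefficients leaving the cell. If [l] lies in no interval
   [[s_k, t_k]] between the k-th eigenvalues of these two matrices, then [C^N] is a direct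
   sum [V + V'] with [M_0 + W - l] negative definite on [V] and [M_0 - W - l] positive
   definite on [V']. With [U = -1] on [V] and [U = 1] on [V'] in every cell, [U^*(J - l)]
   is bounded with coercive real part, so [1 - t U^*(J - l)] is a contraction for small
   [t > 0], and a Neumann series inverts [J - l]. Hence the spectrum is covered by the
   intervals [[s_k, t_k]], whose total length is [2 tr W = r_{al,be}]. *)

(** * Hermitian forms and eigenvalue comparison *)

Section Forms.
Variable R : realType.
Local Notation C := R[i].

Definition adj m n (A : 'M[C]_(m, n)) : 'M[C]_(n, m) := map_mx conjc A^T.

Lemma adjK m n (A : 'M[C]_(m, n)) : adj (adj A) = A.
Proof. by apply/matrixP=> i j; rewrite !mxE conjcK. Qed.

Lemma adjM m n p (A : 'M[C]_(m, n)) (B : 'M[C]_(n, p)) : adj (A *m B) = adj B *m adj A.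
Proof. by rewrite /adj trmx_mul map_mxM. Qed.

Lemma adjD m n (A B : 'M[C]_(m, n)) : adj (A + B) = adj A + adj B.
Proof. by apply/matrixP=> i j; rewrite !mxE rmorphD. Qed.

Lemma adjN m n (A : 'M[C]_(m, n)) : adj (- A) = - adj A.
Proof. by apply/matrixP=> i j; rewrite !mxE rmorphN. Qed.

Lemma adjB m n (A B : 'M[C]_(m, n)) : adj (A - B) = adj A - adj B.
Proof. by rewrite adjD adjN. Qed.

(** Vectors are rows, so the quadratic form of [A] is [ip (v *m A) v]. Keeping only the real part
    makes [ip] a symmetric real bilinear form. Nothing is lost for Hermitian [A], whose form is
    real. *)
Definition ip n (u v : 'rV[C]_n) : R := complex.Re ((u *m adj v) 0 0).
Definition nrm2 n (v : 'rV[C]_n) : R := \sum_k cnorm2 (v 0 k).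

Lemma ReD (x y : C) : complex.Re (x + y) = complex.Re x + complex.Re y.
Proof. by case: x y => [a b] [c d]. Qed.

Lemma ReN (x : C) : complex.Re (- x) = - complex.Re x.
Proof. by case: x. Qed.

Lemma Re_sum (I : Type) (s : seq I) (P : pred I) (F : I -> C) :
  complex.Re (\sum_(i <- s | P i) F i) = \sum_(i <- s | P i) complex.Re (F i).
Proof. by apply: (big_morph (@complex.Re R) ReD). Qed.

Lemma ReZ (r : R) (x : C) : complex.Re (r%:C * x) = r * complex.Re x.
Proof. by case: x => a b /=; rewrite mul0r subr0. Qed.

Lemma cnorm2E (z : C) : cnorm2 z = complex.Re (z * z^*).
Proof. by case: z => a b; rewrite /cnorm2 /=; ring. Qed.

Lemma cnorm2_ge0 (z : C) : 0 <= cnorm2 z.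
Proof. by rewrite addr_ge0 ?sqr_ge0. Qed.

Lemma cnorm2M (x y : C) : cnorm2 (x * y) = cnorm2 x * cnorm2 y.
Proof. by case: x y => [a b] [c d]; rewrite /cnorm2 /=; ring. Qed.

Lemma cnorm2_real (r : R) : cnorm2 r%:C = r ^+ 2.
Proof. by rewrite /cnorm2 /= expr0n addr0. Qed.

Lemma cnorm2_eq0 (z : C) : cnorm2 z = 0 -> z = 0.
Proof.
case: z => a b /eqP; rewrite /cnorm2 /= paddr_eq0 ?sqr_ge0 // !sqrf_eq0.
by case/andP => /eqP-> /eqP->.
Qed.

Lemma ipC n (u v : 'rV[C]_n) : ip u v = ip v u.
Proof.
rewrite /ip !mxE !Re_sum; apply: eq_bigr => k _; rewrite !mxE.
by case: (u _ _) (v _ _) => [a b] [c d] /=; ring.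
Qed.

Lemma ip_adj m n (u : 'rV[C]_m) (A : 'M[C]_(m, n)) (v : 'rV[C]_n) :
  ip (u *m A) v = ip u (v *m adj A).
Proof. by rewrite /ip adjM adjK mulmxA. Qed.

Lemma ipDl n (u v w : 'rV[C]_n) : ip (u + v) w = ip u w + ip v w.
Proof. by rewrite /ip mulmxDl mxE ReD. Qed.

Lemma ipNl n (u w : 'rV[C]_n) : ip (- u) w = - ip u w.
Proof. by rewrite /ip mulNmx mxE ReN. Qed.

Lemma ipDr n (u v w : 'rV[C]_n) : ip w (u + v) = ip w u + ip w v.
Proof. by rewrite !(ipC w) ipDl. Qed.

Lemma ipNr n (u w : 'rV[C]_n) : ip w (- u) = - ip w u.
Proof. by rewrite !(ipC w) ipNl. Qed.

Lemma ip_suml n (I : Type) (s : seq I) (F : I -> 'rV[C]_n) v :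
  ip (\sum_(i <- s) F i) v = \sum_(i <- s) ip (F i) v.
Proof. by rewrite /ip mulmx_suml summxE Re_sum. Qed.

Lemma ip0l n (v : 'rV[C]_n) : ip 0 v = 0.
Proof. by rewrite /ip mul0mx mxE. Qed.

Lemma ip0r n (v : 'rV[C]_n) : ip v 0 = 0.
Proof. by rewrite ipC ip0l. Qed.

Lemma ipZl n (r : R) (u v : 'rV[C]_n) : ip (r%:C *: u) v = r * ip u v.
Proof. by rewrite /ip -scalemxAl mxE ReZ. Qed.

Lemma ipZr n (r : R) (u v : 'rV[C]_n) : ip v (r%:C *: u) = r * ip v u.
Proof. by rewrite !(ipC v) ipZl. Qed.

Lemma ipE n (u v : 'rV[C]_n) : ip u v = \sum_k complex.Re (u 0 k * (v 0 k)^*).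
Proof. by rewrite /ip mxE Re_sum; apply: eq_bigr => k _; rewrite !mxE. Qed.

Lemma ip_nrm2 n (v : 'rV[C]_n) : ip v v = nrm2 v.
Proof. by rewrite ipE; apply: eq_bigr => k _; rewrite cnorm2E. Qed.

Lemma nrm2_ge0 n (v : 'rV[C]_n) : 0 <= nrm2 v.
Proof. by apply: sumr_ge0 => k _; apply: cnorm2_ge0. Qed.

Lemma nrm2_eq0 n (v : 'rV[C]_n) : nrm2 v = 0 -> v = 0.
Proof.
move=> /eqP; rewrite psumr_eq0; last by move=> k _; apply: cnorm2_ge0.
move=> /allP h; apply/rowP => k; rewrite mxE; apply: cnorm2_eq0.
by apply/eqP; exact: h (mem_index_enum k).
Qed.

Lemma nrm2_gt0 n (v : 'rV[C]_n) : v != 0 -> 0 < nrm2 v.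
Proof.
move=> nz; rewrite lt0r nrm2_ge0 andbT; apply/eqP => /nrm2_eq0 v0.
by rewrite v0 eqxx in nz.
Qed.

Lemma nrm2D n (u v : 'rV[C]_n) : nrm2 (u + v) = nrm2 u + nrm2 v + 2 * ip u v.
Proof. by rewrite -!ip_nrm2 !(ipDl, ipDr) (ipC v u); ring. Qed.

Lemma nrm2N n (v : 'rV[C]_n) : nrm2 (- v) = nrm2 v.
Proof. by rewrite -!ip_nrm2 ipNl ipNr opprK. Qed.

Lemma nrm2Z n (r : R) (v : 'rV[C]_n) : nrm2 (r%:C *: v) = r ^+ 2 * nrm2 v.
Proof. by rewrite -!ip_nrm2 ipZl ipZr mulrA. Qed.

Lemma nrm2_0 n : nrm2 (0 : 'rV[C]_n) = 0.
Proof. by rewrite -ip_nrm2 ip0l. Qed.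

Definition diagC n (d : 'I_n -> R) : 'M[C]_n := diag_mx (\row_k (d k)%:C).

Lemma ip_diagC n (d : 'I_n -> R) (v : 'rV[C]_n) :
  ip (v *m diagC d) v = \sum_k d k * cnorm2 (v 0 k).
Proof.
rewrite ipE; apply: eq_bigr => k _.
by rewrite mul_mx_diag !mxE (mulrC _ (d k)%:C) -mulrA ReZ cnorm2E.
Qed.

Lemma adj_diagC n (d : 'I_n -> R) : adj (diagC d) = diagC d.
Proof.
apply/matrixP=> i j; rewrite !mxE eq_sym.
by case: eqP => [->|_]; rewrite ?mulr1n ?mulr0n ?conjc_real ?conjc0.
Qed.

Lemma nrm2_unitary n (P : 'M[C]_n) (v : 'rV[C]_n) :
  P *m adj P = 1%:M -> nrm2 (v *m P) = nrm2 v.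
Proof. by move=> hP; rewrite -!ip_nrm2 ip_adj -mulmxA hP mulmx1. Qed.

Lemma char_poly_conj n (P Q D : 'M[C]_n) :
  Q *m P = 1%:M -> char_poly (Q *m D *m P) = char_poly D.
Proof.
move=> QP; rewrite /char_poly /char_poly_mx.
have h : map_mx polyC Q *m map_mx polyC P = 1%:M by rewrite -map_mxM QP map_mx1.
have -> : 'X%:M - map_mx polyC (Q *m D *m P) =
  map_mx polyC Q *m ('X%:M - map_mx polyC D) *m map_mx polyC P.
  by rewrite mulmxBr mulmxBl !map_mxM scalar_mxC -[_ *m _ *m map_mx _ P in RHS]mulmxA h mulmx1.
by rewrite !det_mulmx mulrC mulrA -det_mulmx (mulmx1C h) det1 mul1r.
Qed.

(** The spectral theorem lists the eigenvalues in an order of its own. Unique factorisation of the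
    characteristic polynomial makes [s] a permutation of that list, and permuting the rows of the
    unitary matrix restores the order of [s]. *)
Lemma sorted_eigs_diag n (A : 'M[C]_n) (s : seq R) : adj A = A ->
  sorted_eigs A s -> size s = n /\
  exists2 P : 'M[C]_n, P *m adj P = 1%:M & A = adj P *m diagC (fun i => nth 0 s i) *m P.
Proof.
move=> hA [ss hs].
have Ah : A \is hermsymmx.
  by apply/is_hermitianmxP; rewrite expr0 scale1r -[LHS]hA.
have dr := hermitian_spectral_diag_real Ah.
have := hermitian_normalmx Ah => /orthomx_spectralP /=.
have := spectral_unitarymx A.
set P := spectralmx A; set d := spectral_diag A => Pu.
rewrite invmx_unitary //.
rewrite -[map_mx _ _]/(adj P).
have PP : P *m adj P = 1%:M by apply/unitarymxP.
have [d' ->] : exists d' : 'I_n -> R, diag_mx d = diagC d'.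
  exists (fun i => complex.Re (d 0 i)); congr diag_mx; apply/rowP => i.
  by rewrite mxE RRe_real //; apply: (mxOverP dr).
move=> AE.
have cp : \prod_(r <- s) ('X - (r%:C)%:P) = \prod_(i < n) ('X - ((d' i)%:C)%:P).
  rewrite -hs {1}AE char_poly_conj ?(mulmx1C PP) //.
  rewrite char_poly_trig ?diag_mx_is_trig //.
  by apply: eq_bigr => i _; rewrite !mxE eqxx mulr1n.
have pe : perm_eq s [seq d' i | i <- enum 'I_n].
  apply: (@perm_map_inj _ _ (real_complex R)); first exact: complexI.
  apply: prod_XsubC_eq; by rewrite 3!big_map cp big_enum.
have sz : size s = n by rewrite (perm_size pe) size_map size_enum_ord.
split=> //.
have /tuple_permP[q qE] : perm_eq s [tuple d' i | i < n].
  by rewrite (perm_trans pe) //= /image_mem.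
exists (row_perm q P).
  by rewrite /adj tr_row_perm map_col_perm; apply/matrixP => i j;
     rewrite !mxE; have /matrixP/(_ (q i) (q j)) := PP; rewrite !mxE (inj_eq perm_inj) => <-;
     apply: eq_bigr => k _; rewrite !mxE.
rewrite {1}AE; apply/matrixP => i j; rewrite !mxE.
rewrite (reindex_inj (@perm_inj _ q)) /=; apply: eq_bigr => k _.
rewrite !mul_mx_diag !mxE; congr (_ * _%:C * _).
by rewrite qE /= nth_mktuple tnth_mktuple.
Qed.

Lemma sorted_eigs_exists n (A : 'M[C]_n) : adj A = A -> exists s, sorted_eigs A s.
Proof.
move=> hA.
have Ah : A \is hermsymmx.
  by apply/is_hermitianmxP; rewrite expr0 scale1r -[LHS]hA.
have dr := hermitian_spectral_diag_real Ah.
have := hermitian_normalmx Ah => /orthomx_spectralP /=.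
have := spectral_unitarymx A.
set P := spectralmx A; set d := spectral_diag A => Pu AE.
exists (sort <=%R [seq complex.Re (d 0 i) | i <- enum 'I_n]); split.
  exact: (sort_sorted le_total).
rewrite {1}AE char_poly_conj ?mulVmx ?unitarymx_unit //.
rewrite char_poly_trig ?diag_mx_is_trig // (perm_big _ (permEl (perm_sort _ _))).
rewrite big_map big_enum /=; apply: eq_bigr => i _.
rewrite !mxE eqxx mulr1n RRe_real //; exact: (mxOverP dr).
Qed.

Lemma ip_spectral n (P : 'M[C]_n) (d : 'I_n -> R) (u : 'rV[C]_n) :
  P *m adj P = 1%:M ->
  ip (u *m P *m (adj P *m diagC d *m P)) (u *m P) = \sum_k d k * cnorm2 (u 0 k).
Proof.
move=> PP; rewrite !mulmxA -(mulmxA u P) PP mulmx1 ip_adj -mulmxA PP mulmx1.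
exact: ip_diagC.
Qed.

(** The rows of [P] are orthonormal eigenvectors. A vector in the span of the first [k] has no
    coordinates beyond [k], so the diagonal form is bounded term by term. *)
Lemma spec_low n (A P : 'M[C]_n) (d : 'I_n -> R) k m (v : 'rV[C]_n) :
  P *m adj P = 1%:M -> A = adj P *m diagC d *m P ->
  (forall i : 'I_n, (i < k)%N -> d i <= m) ->
  (v <= (pid_mx k : 'M[C]_n) *m P)%MS -> ip (v *m A) v <= m * nrm2 v.
Proof.
move=> PP -> hd /submxP[w ->].
rewrite (mulmxA w) ip_spectral // nrm2_unitary // mulr_sumr; apply: ler_sum => i _.
case: (ltnP i k) => ik; first by rewrite ler_wpM2r ?cnorm2_ge0 // hd.
rewrite (_ : (w *m pid_mx k) 0 i = 0) ?cnorm2_real ?expr0n ?mulr0 //.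
rewrite mxE big1 // => j _; rewrite mxE.
by case: eqP => [->|]; rewrite ?mulr0 // ltnNge ik mulr0.
Qed.

Lemma spec_high n (A P : 'M[C]_n) (d : 'I_n -> R) k m (v : 'rV[C]_n) :
  P *m adj P = 1%:M -> A = adj P *m diagC d *m P ->
  (forall i : 'I_n, (k <= i)%N -> m <= d i) ->
  (v <= (copid_mx k : 'M[C]_n) *m P)%MS -> m * nrm2 v <= ip (v *m A) v.
Proof.
move=> PP -> hd /submxP[w ->].
rewrite (mulmxA w) ip_spectral // nrm2_unitary // mulr_sumr; apply: ler_sum => i _.
case: (leqP k i) => ik; first by rewrite ler_wpM2r ?cnorm2_ge0 // hd.
rewrite (_ : (w *m copid_mx k) 0 i = 0) ?cnorm2_real ?expr0n ?mulr0 //.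
rewrite mxE big1 // => j _; rewrite !mxE.
rewrite (inj_eq val_inj); case: (j =P i) => [->|_]; last by rewrite subr0 mulr0.
by rewrite ik subrr mulr0.
Qed.

Lemma nth_sorted_le (s : seq R) i j : sorted <=%R s -> (i <= j)%N -> (j < size s)%N ->
  nth 0 s i <= nth 0 s j.
Proof.
move=> ss ij js; apply: (sorted_leq_nth le_trans lexx 0 ss) => //.
by rewrite inE (leq_ltn_trans ij).
Qed.

(* Weyl's monotonicity: otherwise the first [k.+1] eigenvectors of [B] and the last
   [n - k] eigenvectors of [A] would span subspaces with a common nonzero vector. *)
Lemma sorted_eigs_le n (A B : 'M[C]_n) (s t : seq R) k :
  adj A = A -> adj B = B -> sorted_eigs A s -> sorted_eigs B t ->
  (forall v : 'rV[C]_n, ip (v *m A) v <= ip (v *m B) v) -> (k < n)%N ->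
  nth 0 s k <= nth 0 t k.
Proof.
move=> hA hB eA eB AB kn; rewrite leNgt; apply/negP => ts.
have [ss [P PP AE]] := sorted_eigs_diag hA eA.
have [st [Q QQ BE]] := sorted_eigs_diag hB eB.
pose V := (pid_mx k.+1 : 'M[C]_n) *m Q; pose W := (copid_mx k : 'M[C]_n) *m P.
have rV : \rank V = k.+1.
  by rewrite mxrankMfree ?rank_pid_mx // row_free_unit; case/mulmx1_unit: QQ.
have rW : \rank W = (n - k)%N.
  by rewrite mxrankMfree ?rank_copid_mx ?(ltnW kn) // row_free_unit; case/mulmx1_unit: PP.
have : (V :&: W)%MS != 0.
  rewrite -mxrank_eq0 -lt0n; have := mxrank_sum_cap V W; rewrite rV rW.
  by have := rank_leq_col (V + W)%MS; lia.
case/rowV0Pn=> v; rewrite sub_capmx => /andP[vV vW] /nrm2_gt0 v0.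
have h1 : ip (v *m B) v <= nth 0 t k * nrm2 v.
  apply: spec_low QQ BE _ vV => i ik.
  by apply: nth_sorted_le; rewrite ?st //; case: eB.
have h2 : nth 0 s k * nrm2 v <= ip (v *m A) v.
  apply: spec_high PP AE _ vW => i ik.
  by apply: nth_sorted_le; rewrite ?ss //; case: eA.
have := le_trans h2 (le_trans (AB v) h1).
by rewrite ler_pM2r // leNgt ts.
Qed.

Lemma finite_gap n (P : pred 'I_n) (f : 'I_n -> R) :
  (forall i, P i -> 0 < f i) -> exists2 c : R, 0 < c & forall i, P i -> c <= f i.
Proof.
(* Starting the minimum at [1] keeps it positive for an empty family. *)
move=> h; exists (\big[Order.min/1]_(i | P i) f i).
  by apply: (big_ind (fun x : R => 0 < x)) => // x y x0 y0; rewrite lt_min x0.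
by move=> i Pi; apply: bigmin_le_cond.
Qed.

(** Let [k] count the eigenvalues of [B] below [l]. From index [k] on, [t] is at least [l], so the
    gap hypothesis puts [s] strictly above [l]. The first [k] eigenvectors of [B] and the last
    [n - k] of [A] then span complementary subspaces, and [p] is the projection onto the first along
    the second, in general an oblique one. *)
Lemma gap_projector n (A B : 'M[C]_n) (s t : seq R) (l : R) :
  adj A = A -> adj B = B -> sorted_eigs A s -> sorted_eigs B t ->
  (forall v : 'rV[C]_n, ip (v *m A) v <= ip (v *m B) v) ->
  (forall k, (k < n)%N -> ~~ (nth 0 s k <= l <= nth 0 t k)) ->
  exists2 p : 'M[C]_n, p *m p = p & exists2 c : R, 0 < c &
    forall v : 'rV[C]_n,
      ip (v *m p *m B) (v *m p) - l * nrm2 (v *m p) <= - c * nrm2 (v *m p) /\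
      c * nrm2 (v - v *m p) <= ip ((v - v *m p) *m A) (v - v *m p) - l * nrm2 (v - v *m p).
Proof.
move=> hA hB eA eB AB gap.
have [ss [P PP AE]] := sorted_eigs_diag hA eA.
have [st [Q QQ BE]] := sorted_eigs_diag hB eB.
pose k := count (fun x => x < l) t.
have kn : (k <= n)%N by rewrite -st count_size.
(* If entry [i] of the sorted list [t] were at least [l], so would be all later ones, and at most
   [i] entries could lie below [l]. *)
have tlow (i : 'I_n) : (i < k)%N -> 0 < l - nth 0 t i.
  move=> ik; rewrite subr_gt0 ltNge; apply/negP => lt.
  move: ik; rewrite ltnNge => /negP; apply; rewrite /k -[t](cat_take_drop i) count_cat.
  rewrite [X in (_ + X)%N](_ : _ = 0%N) ?addn0.
    by rewrite (leq_trans (count_size _ _)) // size_take st ltn_ord.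
  apply/eqP; rewrite -leqn0 leqNgt -has_count; apply/hasPn => x /(nthP 0)[j].
  rewrite size_drop st nth_drop => jn <-; rewrite -leNgt (le_trans lt) //.
  by apply: nth_sorted_le; [case: eB | lia | rewrite st; lia].
have thigh (i : 'I_n) : (k <= i)%N -> l <= nth 0 t i.
  move=> ik; rewrite leNgt; apply/negP => lt.
  move: ik; rewrite leqNgt => /negP; apply; rewrite /k -[t](cat_take_drop i.+1) count_cat.
  rewrite [X in (X + _)%N](_ : _ = i.+1) ?leq_addr //.
  have sz : size (take i.+1 t) = i.+1.
    by rewrite size_takel // st.
  rewrite -[RHS]sz; apply/eqP; rewrite -all_count; apply/allP => x /(nthP 0)[j].
  rewrite sz => ji <-; rewrite nth_take // (le_lt_trans _ lt) //.
  by apply: nth_sorted_le; [case: eB | lia | rewrite st].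
have shigh (i : 'I_n) : (k <= i)%N -> 0 < nth 0 s i - l.
  move=> ik; rewrite subr_gt0 ltNge; apply/negP => sl.
  by have := gap i (ltn_ord i); rewrite sl thigh.
have [c1 c1_gt0 hc1] := finite_gap tlow.
have [c2 c2_gt0 hc2] := finite_gap shigh.
pose V := (pid_mx k : 'M[C]_n) *m Q; pose W := (copid_mx k : 'M[C]_n) *m P.
have low v : (v <= V)%MS -> ip (v *m B) v <= (l - c1) * nrm2 v.
  by apply: spec_low QQ BE _ => i /hc1 h; lra.
have high v : (v <= W)%MS -> (l + c2) * nrm2 v <= ip (v *m A) v.
  by apply: spec_high PP AE _ => i /hc2 h; lra.
have rV : \rank V = k.
  by rewrite mxrankMfree ?rank_pid_mx // row_free_unit; case/mulmx1_unit: QQ.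
have rW : \rank W = (n - k)%N.
  by rewrite mxrankMfree ?rank_copid_mx // row_free_unit; case/mulmx1_unit: PP.
(* A common vector has form at least [l + c2] for [A] and at most [l - c1] for [B], per unit of
   squared norm; since [A <= B], it must vanish. *)
have VW0 : (V :&: W)%MS = 0.
  apply/eqP; case: eqP => // /eqP /rowV0Pn[v].
  rewrite sub_capmx => /andP[/low vV /high vW] /nrm2_gt0 v0; exfalso.
  have := le_trans vW (le_trans (AB v) vV).
  by rewrite ler_pM2r //; lra.
have VWfull (v : 'rV[C]_n) : (v <= V + W)%MS.
  apply: submx_full; rewrite /row_full; have := mxrank_sum_cap V W.
  by rewrite VW0 mxrank0 rV rW addn0 => ->; rewrite subnKC //.
exists (proj_mx V W); first exact: proj_mx_proj.
exists (Order.min c1 c2) => [|v]; first by rewrite lt_min c1_gt0.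
split.
  have := low _ (proj_mx_sub V W v).
  have : Order.min c1 c2 * nrm2 (v *m proj_mx V W) <= c1 * nrm2 (v *m proj_mx V W).
    by rewrite ler_wpM2r ?nrm2_ge0 // ge_min lexx.
  by rewrite mulrBl mulNr; lra.
have := high _ (proj_mx_compl_sub (VWfull v)).
set w := v - _.
have : Order.min c1 c2 * nrm2 w <= c2 * nrm2 w.
  by rewrite ler_wpM2r ?nrm2_ge0 // ge_min lexx orbT.
by rewrite mulrDl; lra.
Qed.

End Forms.

(** * Neumann series in l^2 *)

Section Sums.
Variable R : realType.

Lemma sum_uniq_eq (V : nmodType) (I : eqType) (s t : seq I) (G : I -> V) :
  uniq s -> uniq t ->
  (forall x, x \in s -> x \notin t -> G x = 0) ->
  (forall x, x \in t -> x \notin s -> G x = 0) ->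
  \sum_(x <- s) G x = \sum_(x <- t) G x.
Proof.
move=> us ut hs ht.
have cut (a b : seq I) : (forall x, x \in a -> x \notin b -> G x = 0) ->
    \sum_(x <- a) G x = \sum_(x <- [seq x <- a | x \in b]) G x.
  move=> h; rewrite big_filter (bigID (fun x => x \in b)) /=.
  rewrite [X in _ + X]big_seq_cond [X in _ + X]big1 ?addr0 //.
  by move=> x /andP[]; exact: h.
rewrite (cut _ _ hs) (cut _ _ ht); apply: perm_big.
by apply: uniq_perm; rewrite ?filter_uniq // => x; rewrite !mem_filter andbC.
Qed.

Lemma sum_uniq_le (I : eqType) (s t : seq I) (G : I -> R) :
  uniq s -> uniq t -> (forall x, 0 <= G x) ->
  (forall x, x \in s -> x \notin t -> G x = 0) ->
  \sum_(x <- s) G x <= \sum_(x <- t) G x.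
Proof.
move=> us ut G0 hs.
rewrite (@sum_uniq_eq _ _ s [seq x <- t | x \in s]) ?filter_uniq //.
- rewrite big_filter [leRHS](bigID (fun x => x \in s)) /= lerDl.
  by apply: sumr_ge0.
- by move=> x xs; rewrite mem_filter xs /=; apply: hs.
- by move=> x; rewrite mem_filter => /andP[-> _].
Qed.

(** Schur test: [x i * x j] is at most the mean of the two squares, and by symmetry of [w] both
    squares contribute the same total. *)
Lemma sym_weight_sum (I : Type) (s : seq I) (w : I -> I -> R) (x : I -> R) :
  (forall i j, 0 <= w i j) -> (forall i j, w i j = w j i) ->
  \sum_(i <- s) \sum_(j <- s) w i j * (x i * x j) <=
  \sum_(i <- s) x i ^+ 2 * \sum_(j <- s) w i j.
Proof.
move=> w0 wC.
have hE : \sum_(i <- s) x i ^+ 2 * (\sum_(j <- s) w i j) =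
    \sum_(i <- s) \sum_(j <- s) w i j * ((x i ^+ 2 + x j ^+ 2) / 2).
  set S := LHS; have -> : S = (S + S) / 2 by lra.
  rewrite {2}/S; under [X in S + X]eq_bigr do rewrite mulr_sumr.
  rewrite [X in S + X]exchange_big /S -big_split /= mulr_suml; apply: eq_bigr => i _.
  rewrite mulr_sumr -big_split /= mulr_suml; apply: eq_bigr => j _.
  by rewrite (wC j i); field.
rewrite hE; apply: ler_sum => i _; apply: ler_sum => j _; rewrite ler_wpM2l //.
by have := sqr_ge0 (x i - x j); nra.
Qed.

Lemma geometric_small (q b e : R) : 0 <= q < 1 -> 0 < e -> exists k, b * q ^+ k < e.
Proof.
move=> /andP[q0 q1] e0.
have qn : `|q| < 1 by rewrite ger0_norm.
have /cvgrPdist_lt /(_ e e0) [k _ /(_ k (leqnn k))] /= := cvg_geometric b qn.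
rewrite sub0r normrN => h; exists k; exact: le_lt_trans (ler_norm _) h.
Qed.

Lemma le_of_geometric (q a b x : R) : 0 <= q < 1 ->
  (forall k, x <= a + b * q ^+ k) -> x <= a.
Proof.
move=> hq h; apply/ler_addgt0Pr => e e0.
by have [k hk] := geometric_small b hq e0; have := h k; lra.
Qed.

(** With [d = b / (1 - q)], the factor of the geometric tail, the intervals from [u k - d * q ^+ k]
    to [u k + d * q ^+ k] are nested. The supremum of their left ends lies in all of them. *)
Lemma geometric_cauchy_limit (q b : R) (u : nat -> R) : 0 <= q < 1 ->
  (forall k, `|u k.+1 - u k| <= b * q ^+ k) ->
  exists l, forall k, `|u k - l| <= b / (1 - q) * q ^+ k.
Proof.
move=> /andP[q0 q1] h; pose d := b / (1 - q).
have dE : b = d * (1 - q) by rewrite /d; field; lra.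
pose lo k := u k - d * q ^+ k; pose hi k := u k + d * q ^+ k.
have step k : lo k <= lo k.+1 /\ hi k.+1 <= hi k.
  have := h k; rewrite ler_norml dE /lo /hi exprS => /andP[h1 h2]; split; lra.
have lohi k : lo k <= hi k.
  have : 0 <= b * q ^+ k by exact: le_trans (normr_ge0 _) (h k).
  rewrite dE mulrAC pmulr_lge0 ?subr_gt0 // /lo /hi; lra.
have mono_lo i j : (i <= j)%N -> lo i <= lo j.
  by move=> /subnK <-; elim: (j - i)%N => // n /le_trans; apply; case: (step (n + i)%N).
have mono_hi i j : (i <= j)%N -> hi j <= hi i.
  move=> /subnK <-; elim: (j - i)%N => // n; apply: le_trans.
  by case: (step (n + i)%N).
have cross i j : lo i <= hi j.
  case: (leqP i j) => [ij|/ltnW ji]; first exact: le_trans (mono_lo _ _ ij) (lohi j).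
  exact: le_trans (lohi i) (mono_hi _ _ ji).
pose S := [set x | exists k, x = lo k]%classic.
have S0 : S !=set0%classic by exists (lo 0%N), 0%N.
exists (sup S) => k; rewrite ler_norml; apply/andP; split.
  have : sup S <= hi k by apply: sup_le_ub => // x [j ->].
  by rewrite /hi -/d; lra.
have : lo k <= sup S.
  by apply: sup_ubound; [exists (hi 0%N) => x [j ->] | exists k].
by rewrite /lo -/d; lra.
Qed.

End Sums.

Section Neumann.
Variables (R : realType) (K : eqType) (N : nat).
Local Notation C := R[i].
Local Notation fld := (K -> 'rV[C]_N).

(** [M] bounds the squared l^2 norm. Duplicate-free lists stand for finite subsets, so all estimates
    stay within finite sums. *)
Definition l2_le (F : fld) (M : R) : Prop :=
  forall s : seq K, uniq s -> \sum_(c <- s) nrm2 (F c) <= M.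

Lemma l2_le_point F M c : l2_le F M -> nrm2 (F c) <= M.
Proof. by move=> /(_ [:: c] isT); rewrite big_seq1. Qed.

Lemma l2_le_ge0 F M : l2_le F M -> 0 <= M.
Proof. by move=> /(_ [::] isT); rewrite big_nil. Qed.

(** Weighted Young inequality, from expanding the squared norm of [u - e v]. *)
Lemma nrm2D_le n (u v : 'rV[C]_n) (e : R) : 0 < e ->
  nrm2 (u + v) <= (1 + e^-1) * nrm2 u + (1 + e) * nrm2 v.
Proof.
move=> e0.
suff : 0 <= e^-1 * nrm2 (u - e%:C *: v).
  rewrite nrm2D nrm2N nrm2Z ipNr ipZr nrm2D => h.
  have eV : e^-1 * e = 1 by rewrite mulVf // gt_eqF.
  have -> : (1 + e^-1) * nrm2 u + (1 + e) * nrm2 v = nrm2 u + nrm2 v +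
     (e^-1 * nrm2 u + (e^-1 * e) * e * nrm2 v) by rewrite eV; ring.
  rewrite lerD2l -subr_ge0; apply: le_trans h _; rewrite -subr_ge0.
  rewrite [X in 0 <= X](_ : _ = 2 * (e^-1 * e - 1) * ip u v); last by ring.
  by rewrite eV subrr mulr0 mul0r.
by rewrite mulr_ge0 ?invr_ge0 ?nrm2_ge0 // ltW.
Qed.

Lemma nrm2D_le2 n (u v : 'rV[C]_n) : nrm2 (u + v) <= 2 * nrm2 u + 2 * nrm2 v.
Proof. by have := nrm2D_le u v ltr01; rewrite invr1; lra. Qed.

Lemma nrm2B_le2 n (u v : 'rV[C]_n) : nrm2 (u - v) <= 2 * nrm2 u + 2 * nrm2 v.
Proof. by have := nrm2D_le2 u (- v); rewrite nrm2N. Qed.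

(** As [nrm2] is a squared norm, each real and imaginary part moves by at most [sqrt M * r ^+ k]
    with [r = sqrt q]. The scalar limit applies to each of these [2 * n] sequences, and squaring
    gives back [q ^+ k]. *)
Lemma vec_limit n (q M : R) (u : nat -> 'rV[C]_n) : 0 <= q < 1 ->
  (forall k, nrm2 (u k.+1 - u k) <= M * q ^+ k) ->
  exists l, forall k, nrm2 (u k - l) <= 2 * M / (1 - Num.sqrt q) ^+ 2 * n%:R * q ^+ k.
Proof.
move=> /andP[q0 q1] h; pose r := Num.sqrt q.
have r0 : 0 <= r := sqrtr_ge0 q.
have rE : r ^+ 2 = q by rewrite sqr_sqrtr.
have r1 : r < 1 by nra.
have M0 : 0 <= M by have := h 0%N; rewrite expr0 mulr1; apply: le_trans; exact: nrm2_ge0.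
have sq (x : R) k : x ^+ 2 <= M * q ^+ k -> `|x| <= Num.sqrt M * r ^+ k.
  move=> hx; rewrite -ler_sqr ?nnegrE ?mulr_ge0 ?sqrtr_ge0 ?exprn_ge0 //.
  by rewrite exprMn sqr_sqrtr // -exprM mulnC exprM rE real_normK // num_real.
have cn k i : cnorm2 ((u k.+1 - u k) 0 i) <= M * q ^+ k.
  apply: le_trans (h k); rewrite /nrm2 (bigD1 i) //= lerDl.
  by apply: sumr_ge0 => j _; apply: cnorm2_ge0.
have hr : 0 <= r < 1 by rewrite r0.
have lRe i : exists l, forall k,
    `|complex.Re (u k 0 i) - l| <= Num.sqrt M / (1 - r) * r ^+ k.
  apply: geometric_cauchy_limit => // k; apply: sq; apply: le_trans (cn k i).
  by rewrite !mxE /cnorm2 ReD ReN lerDl sqr_ge0.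
have lIm i : exists l, forall k,
    `|complex.Im (u k 0 i) - l| <= Num.sqrt M / (1 - r) * r ^+ k.
  apply: geometric_cauchy_limit => // k; apply: sq; apply: le_trans (cn k i).
  rewrite !mxE /cnorm2.
  case: (u k.+1 0 i) (u k 0 i) => [a b] [a' b'] /=.
  by rewrite lerDr sqr_ge0.
have [f hf] := choice lRe; have [g hg] := choice lIm.
exists (\row_i (f i +i* g i)) => k; rewrite /nrm2.
have -> : 2 * M / (1 - Num.sqrt q) ^+ 2 * n%:R * q ^+ k =
  \sum_(i < n) (2 * (Num.sqrt M / (1 - r) * r ^+ k) ^+ 2).
  rewrite sumr_const card_ord -mulr_natr exprMn -exprM mulnC exprM rE.
  by rewrite exprMn exprVn sqr_sqrtr // -/r; ring.
apply: ler_sum => i _; rewrite !mxE /cnorm2.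
have := hf i k; have := hg i k.
set B := _ * _; case: (u k 0 i) => [a b] /= h1 h2.
have B0 : 0 <= B := le_trans (normr_ge0 _) h1.
have : (a - f i) ^+ 2 <= B ^+ 2 by rewrite -real_normK ?num_real // ler_sqr ?nnegrE.
have : (b - g i) ^+ 2 <= B ^+ 2 by rewrite -real_normK ?num_real // ler_sqr ?nnegrE.
by lra.
Qed.

Variables (L : fld -> fld) (q B : R).
Hypothesis q01 : 0 <= q < 1.
Hypothesis LB : forall F G c, L (fun x => F x - G x) c = L F c - L G c.
Hypothesis Lsup : forall F e, (forall c, nrm2 (F c) <= e) -> forall c, nrm2 (L F c) <= B * e.
Hypothesis Lcontr : forall F M, l2_le F M -> l2_le (L F) (q * M).

Lemma contraction_fix0 F M : l2_le F M -> (forall c, F c = L F c) -> forall c, F c = 0.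
Proof.
move=> FM fix_ c.
have FMk k : l2_le F (M * q ^+ k).
  elim: k => [|k IH]; first by rewrite mulr1.
  rewrite exprS mulrCA => s us; under eq_bigr do rewrite fix_.
  exact: Lcontr.
apply: nrm2_eq0; apply/le_anti; rewrite nrm2_ge0 andbT.
by apply: le_of_geometric q01 _ => k; rewrite add0r; apply: l2_le_point.
Qed.

(** Picard iteration [u k.+1 = G + L (u k)] from zero: consecutive differences decay geometrically
    in l^2, hence at every point, which yields a pointwise limit [F]. The sup bound on [L] carries
    the equation over to [F]. *)
Lemma contraction_solve G M : l2_le G M ->
  exists2 F, (exists M', l2_le F M') & forall c, F c = G c + L F c.
Proof.
move=> GM; have [q0 q1] := andP q01; have M0 := l2_le_ge0 GM.
have L0 c : L (fun=> 0) c = 0.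
  rewrite -[RHS](subrr (L (fun=> 0) c)) -LB.
  by congr (L _ c); apply/funext => x; rewrite subrr.
pose u := fix u k := if k is k'.+1 then (fun c => G c + L (u k') c) else (fun=> 0).
have uS k c : u k.+1 c = G c + L (u k) c by [].
have du k : l2_le (fun c => u k.+1 c - u k c) (M * q ^+ k).
  elim: k => [|k IH].
    move=> s us; rewrite mulr1; under eq_bigr do rewrite uS L0 addr0 subr0.
    exact: GM.
  rewrite exprS mulrCA => s us; apply: le_trans (Lcontr IH us).
  rewrite le_eqVlt; apply/orP; left; apply/eqP; apply: eq_bigr => c _.
  by rewrite LB [u k.+2 c]uS [X in _ - X]uS opprD addrACA subrr add0r.
have lim c : exists l, forall k, nrm2 (u k c - l) <=
    2 * M / (1 - Num.sqrt q) ^+ 2 * N%:R * q ^+ k.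
  by apply: vec_limit => // k; apply: (l2_le_point c (du k)).
have D0 : 0 <= 2 * M / (1 - Num.sqrt q) ^+ 2 * N%:R.
  by rewrite mulr_ge0 // divr_ge0 ?sqr_ge0 // mulr_ge0.
have [F] := choice lim; move: D0; set D := 2 * M / _ * _ => D0 hF; clearbody D.
pose e := 1 - q; have e0 : 0 < e by rewrite subr_gt0.
(* [M'] solves [(1 + e^-1) * M + (1 + e) * q * M' = M'], since [(1 + e) * q = 1 - e ^+ 2]. The l^2
   bound therefore reproduces itself along the iteration. *)
pose M' := (1 + e^-1) * M / (e ^+ 2).
have e20 : 0 < e ^+ 2 by rewrite exprn_gt0.
have uM' k : l2_le (u k) M'.
  have M'0 : 0 <= M'.
    by rewrite /M' divr_ge0 ?(ltW e20) // mulr_ge0 // addr_ge0 // invr_ge0 ltW.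
  elim: k => [|k IH] s us.
    by rewrite big1 // => c _; rewrite nrm2_0.
  apply: le_trans (_ : \sum_(c <- s) ((1 + e^-1) * nrm2 (G c) + (1 + e) * nrm2 (L (u k) c)) <= _).
    by apply: ler_sum => c _; rewrite uS; apply: nrm2D_le.
  rewrite big_split /= -!mulr_sumr.
  have h1 : (1 + e^-1) * (\sum_(c <- s) nrm2 (G c)) <= (1 + e^-1) * M.
    by rewrite ler_wpM2l ?GM // addr_ge0 // invr_ge0 ltW.
  have h2 : (1 + e) * (\sum_(c <- s) nrm2 (L (u k) c)) <= (1 + e) * (q * M').
    by rewrite ler_wpM2l ?(Lcontr IH) // addr_ge0 // ltW.
  apply: le_trans (lerD h1 h2) _.
  have -> : (1 + e^-1) * M = M' * e ^+ 2 by rewrite /M' mulfVK // gt_eqF.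
  by rewrite le_eqVlt; apply/orP; left; apply/eqP; rewrite /e; ring.
exists F.
  exists (2 * M') => s us.
  (* The pointwise error depends on the length of [s] but vanishes as [k] grows, leaving the bound
     [2 * M'], the same for every [s]. *)
  apply: le_of_geometric q01 (_ : forall k, _ <= _ + (2 * (size s)%:R * D) * q ^+ k) => k.
  apply: le_trans (_ : \sum_(c <- s) (2 * nrm2 (u k c) + 2 * nrm2 (u k c - F c)) <= _).
    apply: ler_sum => c _.
    by rewrite -[F c in leLHS](subKr (u k c)); apply: nrm2B_le2.
  rewrite big_split /= -!mulr_sumr lerD //; first by rewrite ler_wpM2l // uM'.
  rewrite -!mulrA ler_wpM2l //.
  apply: le_trans (_ : \sum_(c <- s) D * q ^+ k <= _); first exact: ler_sum.
  by rewrite big_const_seq count_predT iter_addr_0 mulr_natl.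
move=> c; apply/eqP; rewrite -subr_eq0; apply/eqP; apply: nrm2_eq0.
apply/le_anti; rewrite nrm2_ge0 andbT.
apply: le_of_geometric q01 (_ : forall k, _ <= _ + (2 * (B * D) + 2 * D) * q ^+ k) => k.
have -> : F c - (G c + L F c) = (L (fun x => u k x - F x) c) - (u k.+1 c - F c).
  by rewrite LB uS; apply/rowP => i; rewrite !mxE; ring.
rewrite add0r mulrDl; apply: le_trans (nrm2B_le2 _ _) _.
apply: lerD; rewrite -!mulrA ler_wpM2l //; first exact: (Lsup (hF^~ k)).
apply: le_trans (hF c k.+1) _; rewrite exprS ler_wpM2l //.
by rewrite ler_piMl ?exprn_ge0 // ltW.
Qed.

End Neumann.

(** * Block Toeplitz operators *)

Section Gershgorin.
Variable R : realType.
Local Notation C := R[i].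

Lemma cabs_ge0 (z : C) : 0 <= cabs z.
Proof. exact: sqrtr_ge0. Qed.

Lemma sqr_cabs (z : C) : cabs z ^+ 2 = cnorm2 z.
Proof. by rewrite sqr_sqrtr ?cnorm2_ge0. Qed.

Lemma cabsM (x y : C) : cabs (x * y) = cabs x * cabs y.
Proof. by rewrite /cabs cnorm2M sqrtrM ?cnorm2_ge0. Qed.

Lemma cabs_conj (z : C) : cabs (conjc z) = cabs z.
Proof. by case: z => a b; rewrite /cabs /cnorm2 /= sqrrN. Qed.

Lemma cabs0 : cabs (0 : C) = 0.
Proof. by rewrite /cabs /cnorm2 /= expr0n addr0 sqrtr0. Qed.

Lemma normRe_le_cabs (z : C) : `|complex.Re z| <= cabs z.
Proof. by rewrite -sqrtr_sqr ler_wsqrtr // lerDl sqr_ge0. Qed.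

Lemma ip_mx_le n (A : 'M[C]_n) (u v : 'rV[C]_n) :
  `|ip (u *m A) v| <= \sum_k \sum_j cabs (A j k) * (cabs (v 0 k) * cabs (u 0 j)).
Proof.
rewrite ipE; apply: le_trans (ler_norm_sum _ _ _) _; apply: ler_sum => k _.
rewrite mxE mulr_suml Re_sum; apply: le_trans (ler_norm_sum _ _ _) _.
apply: ler_sum => j _; apply: le_trans (normRe_le_cabs _) _.
by rewrite !cabsM cabs_conj; lra.
Qed.

(** For Hermitian [A] the moduli of the entries form a symmetric weight, so the Schur test turns
    column sums into a bound on the form. *)
Lemma gershgorin_form n (A : 'M[C]_n) (w : 'I_n -> R) (v : 'rV[C]_n) :
  adj A = A -> (forall k, \sum_j cabs (A j k) <= w k) ->
  `|ip (v *m A) v| <= ip (v *m diagC w) v.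
Proof.
move=> hA hw; apply: le_trans (ip_mx_le _ _ _) _.
have sA i j : cabs (A i j) = cabs (A j i) by rewrite -{1}hA !mxE cabs_conj.
apply: le_trans (sym_weight_sum _ _ _ _) _ => [i j|i j|]; [exact: cabs_ge0|exact: sA|].
rewrite ip_diagC; apply: ler_sum => k _; rewrite sqr_cabs mulrC.
by rewrite ler_wpM2r ?cnorm2_ge0.
Qed.

Lemma form_sandwich n (A B W : 'M[C]_n) (v : 'rV[C]_n) :
  `|ip (v *m (A - B)) v| <= ip (v *m W) v ->
  ip (v *m (B - W)) v <= ip (v *m A) v /\ ip (v *m A) v <= ip (v *m (B + W)) v.
Proof. by rewrite ler_norml !mulmxBr mulmxDr !ipDl !ipNl => /andP[]; split; lra. Qed.

End Gershgorin.

Section BlockToeplitz.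
Variables (R : realType) (K : zmodType) (N : nat).
Local Notation C := R[i].
Local Notation fld := (K -> 'rV[C]_N).
Variables (D : seq K) (m : K -> 'M[C]_N) (w : 'I_N -> R).

Definition block_toeplitz (F : fld) : fld := fun c => \sum_(d <- D) F (c + d) *m m d.
Local Notation T := block_toeplitz.

Hypothesis uD : uniq D.
Hypothesis mD : forall d, d \notin D -> m d = 0.
Hypothesis mN : forall d, adj (m d) = m (- d).
Hypothesis mw : forall k, \sum_(d <- D | d != 0) \sum_j cabs (m d j k) <= w k.

(** The pairing of [T F] with [G] in which both cells are restricted to the finite window [s]. *)
Definition block_form (s : seq K) (F G : fld) : R :=
  \sum_(c <- s) \sum_(e <- s) ip (F e *m m (e - c)) (G c).

Lemma block_formC s F G : block_form s F G = block_form s G F.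
Proof.
rewrite /block_form exchange_big /=; apply: eq_bigr => e _; apply: eq_bigr => c _.
by rewrite ip_adj mN opprB ipC.
Qed.

Lemma block_formDl s F G E :
  block_form s (fun c => F c + G c) E = block_form s F E + block_form s G E.
Proof.
rewrite /block_form -big_split; apply: eq_bigr => c _; rewrite -big_split /=.
by apply: eq_bigr => e _; rewrite mulmxDl ipDl.
Qed.

Lemma block_formNl s F E : block_form s (fun c => - F c) E = - block_form s F E.
Proof.
rewrite /block_form -sumrN; apply: eq_bigr => c _; rewrite -sumrN.
by apply: eq_bigr => e _; rewrite mulNmx ipNl.
Qed.

(** Pairs of a cell and a component index one large Hermitian matrix, restricted to the window. With
    its diagonal blocks removed, its absolute column sums are at most [w], and the Schur test
    applies. *)
Lemma block_form_offdiag_le s F : uniq s ->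
  `|block_form s F F - \sum_(c <- s) ip (F c *m m 0) (F c)|
   <= \sum_(c <- s) ip (F c *m diagC w) (F c).
Proof.
move=> us.
have -> : block_form s F F - \sum_(c <- s) ip (F c *m m 0) (F c) =
    \sum_(c <- s) \sum_(e <- s | e != c) ip (F e *m m (e - c)) (F c).
  apply/eqP; rewrite subr_eq -big_split /=; apply/eqP.
  rewrite /block_form big_seq [RHS]big_seq; apply: eq_bigr => c cs.
  rewrite (bigID (fun e => e != c)) /=; congr (_ + _).
  under eq_bigl do rewrite negbK.
  by rewrite -big_filter filter_pred1_uniq // big_seq1 subrr.
pose W (x y : K * 'I_N) : R := if y.1 == x.1 then 0 else cabs (m (y.1 - x.1) y.2 x.2).
pose X (x : K * 'I_N) : R := cabs (F x.1 0 x.2).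
pose ss := [seq (c, k) | c <- s, k <- enum 'I_N].
have sumE (f : K * 'I_N -> R) : \sum_(x <- ss) f x = \sum_(c <- s) \sum_k f (c, k).
  by rewrite /ss big_allpairs_dep; apply: eq_bigr => c _; rewrite big_enum.
apply: le_trans (_ : \sum_(x <- ss) \sum_(y <- ss) W x y * (X x * X y) <= _).
  rewrite sumE; apply: le_trans (ler_norm_sum _ _ _) _; apply: ler_sum => c _.
  under [leRHS]eq_bigr do rewrite sumE.
  rewrite exchange_big /= big_mkcond; apply: le_trans (ler_norm_sum _ _ _) _.
  apply: ler_sum => e _; rewrite /W /X /=; case: eqP => /= _.
    by rewrite normr0; apply: sumr_ge0 => k _; apply: sumr_ge0 => j _; rewrite mul0r.
  exact: ip_mx_le.
apply: le_trans (sym_weight_sum _ _ _ _) _ => [x y|x y|].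
- by rewrite /W; case: ifP => // _; apply: cabs_ge0.
- rewrite /W eq_sym; case: ifP => // _.
  by rewrite -opprB -mN !mxE cabs_conj.
rewrite sumE; apply: ler_sum => c _; rewrite ip_diagC; apply: ler_sum => k _.
rewrite /X sqr_cabs mulrC ler_wpM2r ?cnorm2_ge0 //.
apply: le_trans (mw k); rewrite sumE /W /= [leRHS]big_mkcond /=.
(* Each weight depends only on the difference of cells, so the column sum is reindexed by [e - c].
   These differences are distinct, and blocks outside [D] contribute zero. *)
pose g (d : K) : R := if d != 0 then \sum_j cabs (m d j k) else 0.
rewrite (eq_bigr (fun e => g (e - c))); last first.
  move=> e _; rewrite /g subr_eq0; case: eqP => //= _.
  by rewrite big1.
rewrite -(big_map (fun e => e - c) xpredT g); apply: sum_uniq_le => //.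
- by rewrite map_inj_uniq //; apply: addIr.
- by move=> d; rewrite /g; case: ifP => // _; apply: sumr_ge0 => j _; apply: cabs_ge0.
move=> d _ /mD dD; rewrite /g; case: ifP => // _.
by apply: big1 => j _; rewrite dD mxE cabs0.
Qed.

Lemma nrm2_sum_le n (I : Type) (s : seq I) (f : I -> 'rV[C]_n) :
  nrm2 (\sum_(i <- s) f i) <= (size s)%:R * \sum_(i <- s) nrm2 (f i).
Proof.
elim: s => [|i s IH]; first by rewrite !big_nil nrm2_0 mul0r.
rewrite !big_cons /=; case: s IH => [|j s] IH.
  by rewrite !big_nil !addr0 mul1r.
set t := j :: s in IH *.
have n0 : 0 < (size t)%:R :> R by rewrite ltr0n.
(* The parameter [e = 1 / size t] gives the coefficients [size t + 1] and [1 + 1 / size t]; the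
   latter times [size t] is again [size t + 1]. *)
apply: le_trans (nrm2D_le _ _ (_ : 0 < (size t)%:R^-1)) _; first by rewrite invr_gt0.
rewrite invrK -(natr1 (size t)) mulrDr (addrC 1 (_%:R)) lerD //.
apply: le_trans (ler_wpM2l _ IH) _; first by rewrite addr_ge0 // invr_ge0 ltW.
by rewrite mulrA mulrDl mul1r mulVf ?gt_eqF.
Qed.

Lemma nrm2_mulmx_le n (A : 'M[C]_n) :
  exists2 b : R, 0 <= b & forall v : 'rV[C]_n, nrm2 (v *m A) <= b * nrm2 v.
Proof.
exists (n%:R * \sum_k nrm2 (row k A)).
  by rewrite mulr_ge0 // sumr_ge0 // => k _; apply: nrm2_ge0.
move=> v; rewrite mulmx_sum_row; apply: le_trans (nrm2_sum_le _ _) _.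
have -> : size (index_enum 'I_n) = n by rewrite -[index_enum _]enumT size_enum_ord.
rewrite -mulrA ler_wpM2l // mulr_suml; apply: ler_sum => k _.
have -> : nrm2 (v 0 k *: row k A) = nrm2 (row k A) * cnorm2 (v 0 k).
  by rewrite /nrm2 mulr_suml; apply: eq_bigr => j _; rewrite !mxE cnorm2M mulrC.
rewrite ler_wpM2l ?nrm2_ge0 // /nrm2 (bigD1 k) //= lerDl.
by apply: sumr_ge0 => j _; apply: cnorm2_ge0.
Qed.

Lemma block_bound : exists2 b : R, 0 <= b &
  forall (F : fld) c, nrm2 (T F c) <= b * \sum_(d <- D) nrm2 (F (c + d)).
Proof.
have [b hb] := choice (fun d => let: ex_intro2 b b0 h := nrm2_mulmx_le (m d) in
                                ex_intro (fun b => 0 <= b /\ _) b (conj b0 h)).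
have sb0 : 0 <= \sum_(d <- D) b d by apply: sumr_ge0 => d _; case: (hb d).
exists ((size D)%:R * \sum_(d <- D) b d); first by rewrite mulr_ge0.
move=> F c; apply: le_trans (nrm2_sum_le _ _) _.
rewrite -mulrA ler_wpM2l // mulr_sumr big_seq [leRHS]big_seq; apply: ler_sum => d dD.
apply: le_trans ((hb d).2 _) _; rewrite ler_wpM2r ?nrm2_ge0 //.
rewrite (big_rem d) //= lerDl; apply: sumr_ge0 => x _; by case: (hb x).
Qed.

Lemma block_toeplitzB (F G : fld) c : T (fun x => F x - G x) c = T F c - T G c.
Proof. by rewrite /T -sumrB; apply: eq_bigr => d _; rewrite mulmxBl. Qed.

Lemma sum_shift_le (F : fld) M s : l2_le F M -> uniq s ->
  \sum_(c <- s) \sum_(d <- D) nrm2 (F (c + d)) <= (size D)%:R * M.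
Proof.
move=> FM us; rewrite exchange_big /=.
apply: le_trans (_ : \sum_(d <- D) M <= _); last first.
  by rewrite big_const_seq count_predT iter_addr_0 mulr_natl.
apply: ler_sum => d _; rewrite -(big_map (fun c => c + d) xpredT (fun c => nrm2 (F c))).
by apply: FM; rewrite map_inj_uniq //; apply: addIr.
Qed.

Lemma block_form_pairing s g (F : fld) (u : 'M[C]_N) : uniq s -> uniq g -> {subset s <= g} ->
  (forall c, c \notin s -> F c = 0) ->
  \sum_(c <- g) ip (T F c) (F c *m u) = block_form s F (fun c => F c *m u).
Proof.
move=> us ug sg F0.
have -> : \sum_(c <- g) ip (T F c) (F c *m u) = \sum_(c <- s) ip (T F c) (F c *m u).
  apply: sum_uniq_eq => // c; last by move=> /sg ->.
  by move=> _ /F0 ->; rewrite mul0mx ip0r.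
apply: eq_bigr => c _; rewrite -ip_suml; congr (ip _ _).
rewrite /T (eq_bigr (fun d => F (c + d) *m m (c + d - c))); last first.
  by move=> d _; rewrite addrAC subrr add0r.
rewrite -(big_map (fun d => c + d) xpredT (fun e => F e *m m (e - c))).
apply: sum_uniq_eq => //; first by rewrite map_inj_uniq //; apply: addrI.
  by move=> e _ /F0 ->; rewrite mul0mx.
move=> e _ he; rewrite mD ?mulmx0 //; apply: contra he => he.
by apply/mapP; exists (e - c); rewrite // addrC subrK.
Qed.

(** * Inversion of a block Toeplitz operator from definiteness on two complementary subspaces *)

Variables (p : 'M[C]_N) (c0 : R).
Hypothesis pp : p *m p = p.
Hypothesis c0_gt0 : 0 < c0.
Hypothesis plow : forall v : 'rV[C]_N,
  ip (v *m p *m (m 0 + diagC w)) (v *m p) <= - c0 * nrm2 (v *m p).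
Hypothesis phigh : forall v : 'rV[C]_N,
  c0 * nrm2 (v - v *m p) <= ip ((v - v *m p) *m (m 0 - diagC w)) (v - v *m p).

(** The reflection [U] equal to [-1] on the range of [p] and [1] on its kernel. It is an involution,
    but [p] may be oblique, so [adj u] has to be kept apart from [u]. *)
Let u : 'M[C]_N := 1%:M - p - p.

Let uu : u *m u = 1%:M.
Proof.
rewrite /u !(mulmxBl, mulmxBr, mul1mx, mulmx1) pp.
by apply/matrixP => i j; rewrite !mxE; ring.
Qed.

(* For [F = X + Y] with [X] in the negative and [Y] in the positive subspace, the
   cross terms of [<T F, Y - X>] cancel since [T] is symmetric. *)
Lemma block_coercive s (F : fld) : uniq s ->
  c0 / 2 * \sum_(c <- s) nrm2 (F c) <= block_form s F (fun c => F c *m u).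
Proof.
move=> us; pose X c := F c *m p; pose Y c := F c - F c *m p.
have -> : block_form s F (fun c => F c *m u) = block_form s Y Y - block_form s X X.
  have -> : F = fun c => X c + Y c by apply/funext => c; rewrite /X /Y addrC subrK.
  rewrite block_formC.
  have -> : (fun c => (X c + Y c) *m u) = fun c => Y c + (- X c).
    apply/funext => c; rewrite /X /Y [_ + (_ - _)]addrC subrK.
    by rewrite /u !mulmxBr mulmx1.
  have eD E : block_form s E (fun c => X c + Y c) = block_form s E X + block_form s E Y.
    by rewrite block_formC block_formDl !(block_formC _ E).
  by rewrite block_formDl block_formNl !eD (block_formC s X Y); ring.
have hY := block_form_offdiag_le Y us; have hX := block_form_offdiag_le X us.
have eY : c0 * \sum_(c <- s) nrm2 (Y c) <=
    \sum_(c <- s) ip (Y c *m m 0) (Y c) - \sum_(c <- s) ip (Y c *m diagC w) (Y c).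
  rewrite mulr_sumr -sumrB; apply: ler_sum => c _.
  by apply: le_trans (phigh (F c)) _; rewrite mulmxBr ipDl ipNl.
have eX : \sum_(c <- s) ip (X c *m m 0) (X c) + \sum_(c <- s) ip (X c *m diagC w) (X c)
    <= - (c0 * \sum_(c <- s) nrm2 (X c)).
  rewrite mulr_sumr -sumrN -big_split; apply: ler_sum => c _ /=.
  by rewrite -mulNr; apply: le_trans (plow (F c)); rewrite mulmxDr ipDl.
have : \sum_(c <- s) nrm2 (F c) <= 2 * \sum_(c <- s) nrm2 (X c) + 2 * \sum_(c <- s) nrm2 (Y c).
  rewrite !mulr_sumr -big_split; apply: ler_sum => c _ /=.
  have -> : nrm2 (F c) = nrm2 (X c + Y c) by rewrite /X /Y addrC subrK.
  exact: nrm2D_le2.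
move: hY hX; rewrite !ler_norml => /andP[hY _] /andP[_ hX] h.
have := ler_wpM2l (ltW c0_gt0) h; lra.
Qed.

Let relax (t : R) (F : fld) : fld := fun c => F c - t%:C *: (T F c *m adj u).

(** Expanding the square gives [|F|^2 - 2 t <T F, F u> + t^2 |T F u^*|^2]. Coercivity makes the
    middle term at most [- t c0 |F|^2], and boundedness controls the last one. *)
Lemma relax_contraction : exists t q : R,
  [/\ t != 0, 0 <= q < 1 & forall F M, l2_le F M -> l2_le (relax t F) (q * M)].
Proof.
have [b1 b1_ge0 hb1] := block_bound; have [b2 b2_ge0 hb2] := nrm2_mulmx_le (adj u).
(* The summand [c0 ^+ 2] ensures [0 < M0] and [c0 ^+ 2 <= M0], hence [0 <= q < 1]. The chosen [t]
   minimises [1 - t * c0 + t ^+ 2 * M0], and [q] is the minimum. *)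
pose M0 := b2 * (b1 * (size D)%:R) + c0 ^+ 2.
have M0_gt0 : 0 < M0 by rewrite ltr_wpDl ?exprn_gt0 // !mulr_ge0.
pose t := c0 / (2 * M0); pose q := 1 - c0 ^+ 2 / (4 * M0).
have t_gt0 : 0 < t by rewrite divr_gt0 // mulr_gt0.
have qE : q = 1 - t * c0 + t ^+ 2 * M0 by rewrite /q /t; field; rewrite gt_eqF.
have cM : c0 ^+ 2 <= M0 by rewrite lerDr !mulr_ge0.
have x0 : 0 < c0 ^+ 2 / (4 * M0) by rewrite divr_gt0 ?exprn_gt0 // mulr_gt0.
have x1 : c0 ^+ 2 / (4 * M0) <= 1 by rewrite ler_pdivrMr ?mulr_gt0 // mul1r; lra.
have q01 : 0 <= q < 1 by rewrite /q; lra.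
exists t, q; split=> //; first by rewrite gt_eqF.
have Tb F M s : l2_le F M -> uniq s -> \sum_(c <- s) nrm2 (T F c *m adj u) <= M0 * M.
  move=> FM us; have M_ge0 := l2_le_ge0 FM.
  apply: le_trans (_ : \sum_(c <- s) b2 * (b1 * \sum_(d <- D) nrm2 (F (c + d))) <= _).
    by apply: ler_sum => c _; apply: le_trans (hb2 _) _; rewrite ler_wpM2l.
  rewrite -!mulr_sumr; apply: le_trans (_ : b2 * (b1 * ((size D)%:R * M)) <= _).
    by rewrite !ler_wpM2l //; apply: sum_shift_le.
  by rewrite !mulrA ler_wpM2r // /M0 !mulrA lerDl sqr_ge0.
have fin F s g : uniq s -> uniq g -> {subset s <= g} -> (forall c, c \notin s -> F c = 0) ->
    \sum_(c <- g) nrm2 (relax t F c) <= q * \sum_(c <- s) nrm2 (F c).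
  move=> us ug sg F0; set S := \sum_(c <- s) _.
  have FS : l2_le F S.
    move=> h uh; apply: sum_uniq_le => // [c|c _ /F0 ->]; [exact: nrm2_ge0|exact: nrm2_0].
  have -> : \sum_(c <- g) nrm2 (relax t F c) =
      \sum_(c <- g) nrm2 (F c) + t ^+ 2 * (\sum_(c <- g) nrm2 (T F c *m adj u)) -
      2 * t * \sum_(c <- g) ip (T F c) (F c *m u).
    rewrite !mulr_sumr -big_split -sumrB; apply: eq_bigr => c _ /=.
    rewrite /relax nrm2D nrm2N nrm2Z ipNr ipZr ipC ip_adj adjK; ring.
  rewrite (block_form_pairing _ us ug sg F0).
  have h1 : \sum_(c <- g) nrm2 (F c) <= S := FS g ug.
  have h2 := ler_wpM2l (sqr_ge0 t) (Tb _ _ _ FS ug).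
  have h3 := ler_wpM2l (ltW t_gt0) (block_coercive F us).
  rewrite qE; move: h3; rewrite -/S; lra.
move=> F M FM g ug.
(* A general [F] is cut off to a finite window containing [g] and all its translates by [D]; this
   leaves [relax t F] unchanged on [g]. *)
pose s := undup (g ++ flatten [seq c :: [seq c + d | d <- D] | c <- g]).
pose F' c := if c \in s then F c else 0.
have gs c : c \in g -> c \in s by rewrite mem_undup mem_cat => ->.
have gDs c d : c \in g -> d \in D -> c + d \in s.
  move=> cg dD; rewrite mem_undup mem_cat; apply/orP; right.
  apply/flattenP; exists (c :: [seq c + d | d <- D]); first exact: map_f.
  by rewrite inE map_f // orbT.
have -> : \sum_(c <- g) nrm2 (relax t F c) = \sum_(c <- g) nrm2 (relax t F' c).
  apply: eq_big_seq => c cg.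
  have eF : F' c = F c by rewrite /F' gs.
  have eT : T F' c = T F c.
    by apply: eq_big_seq => d dD; rewrite /F' gDs.
  by rewrite /relax eF eT.
apply: le_trans (_ : \sum_(c <- s) nrm2 (relax t F' c) <= _).
  apply: sum_uniq_le; rewrite ?undup_uniq // => c; first exact: nrm2_ge0.
  by move=> /gs ->.
apply: le_trans (fin F' s s (undup_uniq _) (undup_uniq _) _ _) _ => //.
  by move=> c /negbTE cs; rewrite /F' cs.
rewrite ler_wpM2l //; first by case/andP: q01.
rewrite big_seq (eq_bigr (fun c => nrm2 (F c))) -?big_seq; first exact: FM (undup_uniq _).
by move=> c cs; rewrite /F' cs.
Qed.

Lemma l2_le_mulmx (F : fld) M (A : 'M[C]_N) : l2_le F M -> exists M', l2_le (fun c => F c *m A) M'.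
Proof.
move=> FM; have [b b0 hb] := nrm2_mulmx_le A; exists (b * M) => s us.
apply: le_trans (_ : b * \sum_(c <- s) nrm2 (F c) <= _); last by rewrite ler_wpM2l // FM.
by rewrite mulr_sumr; apply: ler_sum.
Qed.

(** A fixed point of [F = t G u^* + relax t F] satisfies [t (G - T F) u^* = 0], hence [T F = G]
    because [t] is nonzero and [u^*] is an involution. If [T F = 0], then [F] is a fixed point of
    the contraction and vanishes. *)
Lemma block_toeplitz_bijective :
  (forall (G : fld) M, l2_le G M ->
     exists2 F : fld, (exists M', l2_le F M') & forall c, T F c = G c) /\
  (forall (F : fld) M, l2_le F M -> (forall c, T F c = 0) -> forall c, F c = 0).
Proof.
have [t [q [t0 q01 hq]]] := relax_contraction.
have [b1 b1_ge0 hb1] := block_bound; have [b2 b2_ge0 hb2] := nrm2_mulmx_le (adj u).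
have aa : adj u *m adj u = 1%:M by rewrite -adjM uu /adj trmx1 map_mx1.
have relaxB F G c : relax t (fun x => F x - G x) c = relax t F c - relax t G c.
  by rewrite /relax block_toeplitzB mulmxBl scalerBr; apply/rowP => i; rewrite !mxE; ring.
pose B := 2 + 2 * (t ^+ 2 * (b2 * (b1 * (size D)%:R))).
have relax_sup F e : (forall c, nrm2 (F c) <= e) -> forall c, nrm2 (relax t F c) <= B * e.
  move=> Fe c; apply: le_trans (nrm2B_le2 _ _) _; rewrite nrm2Z.
  suff h : nrm2 (T F c *m adj u) <= b2 * (b1 * ((size D)%:R * e)).
    by have := ler_wpM2l (sqr_ge0 t) h; have := Fe c; rewrite /B; lra.
  apply: le_trans (hb2 _) _; rewrite ler_wpM2l //.
  apply: le_trans (hb1 _ _) _; rewrite ler_wpM2l //.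
  apply: le_trans (ler_sum _ (fun d _ => Fe (c + d))) _.
  by rewrite big_const_seq count_predT iter_addr_0 mulr_natl.
split=> [G M GM|F M FM TF0]; last first.
  apply: (contraction_fix0 q01 hq FM) => c.
  by rewrite /relax TF0 mul0mx scaler0 subr0.
have [M' GM'] := l2_le_mulmx (t%:C *: adj u) GM.
have [F FM hF] := contraction_solve q01 relaxB relax_sup hq GM'.
exists F => // c; have := hF c; rewrite /relax => /eqP.
rewrite addrCA -{1}[F c]addr0 (inj_eq (addrI (F c))) eq_sym.
rewrite -scalemxAr -scalerBr scaler_eq0 => /orP[|].
  by rewrite eq_complex /= (negbTE t0).
rewrite -mulmxBl => /eqP h.
have : (G c - T F c) *m adj u *m adj u = 0 by rewrite h mul0mx.
by rewrite -mulmxA aa mulmx1 => /eqP; rewrite subr_eq0 => /eqP ->.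
Qed.

End BlockToeplitz.

(** * The matrices J(x,y), J_0 and C *)

Lemma sum_ord_mul (V : nmodType) (p q : nat) (f : nat -> nat -> V) :
  \sum_(i < p * q) f (i %/ q)%N (i %% q)%N = \sum_(a < p) \sum_(b < q) f a b.
Proof.
case: q => [|q].
  rewrite muln0 big_ord0; under eq_bigr do rewrite big_ord0.
  by rewrite big1.
elim: p => [|p IH]; first by rewrite !big_ord0.
rewrite [RHS]big_ord_recr -IH /= -(big_mkord xpredT (fun i => f (i %/ q.+1)%N (i %% q.+1)%N)).
rewrite mulSnr (big_cat_nat (n := (p * q.+1)%N)) ?leq_addr //= big_mkord; congr (_ + _).
rewrite -{1}[(p * _)%N]add0n big_addn addKn big_mkord; apply: eq_bigr => b _.
by rewrite addnC divnMDl // divn_small // addn0 modnMDl modn_small.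
Qed.

Lemma sum_ord_pick (V : nmodType) (p t : nat) (g : nat -> V) :
  \sum_(u < p) (if (u : nat) == t then g u else 0) = if (t < p)%N then g t else 0.
Proof.
case: ltnP => tp.
  rewrite (bigD1 (Ordinal tp)) //= eqxx big1 ?addr0 // => u.
  by rewrite -val_eqE /= => /negbTE ->.
by apply: big1 => u _; case: eqP => // ut; have := ltn_ord u; lia.
Qed.

Section MatrixBounds.
Variables (R : realType) (p1 p2 : nat) (a0 a1 b0 b1 : int -> int -> R[i]).
Hypotheses (p1_ge3 : (3 <= p1)%N) (p2_ge3 : (3 <= p2)%N).
Hypothesis b1_real : forall n m, complex.Im (b1 n m) = 0.

(* The notation [^*] of the definitions elaborates to either side depending on the
   scope of its position. *)
Lemma conjE (z : R[i]) : Num.conj z = conjc z.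
Proof. by []. Qed.

Lemma conjcM (x y : R[i]) : conjc (x * y) = conjc x * conjc y.
Proof. exact: rmorphM. Qed.

Lemma cabs_expi (x : R) : cabs (expi x) = 1.
Proof. by rewrite /cabs /cnorm2 /= cos2Dsin2 sqrtr1. Qed.

Lemma conj_b1 n m : (b1 n m)^* = b1 n m.
Proof. by have := b1_real n m; case: (b1 n m) => a b /= ->; rewrite oppr0. Qed.

(** Modulus of the two wrap-around entries by which a hatted block differs from its truncation. The
    phase has modulus one, which is why [x] disappears. *)
Definition corner (c : int -> int -> R[i]) (n : int) (u v : nat) : R :=
  cabs (c n p2%:Z) * (((u == 0%N) && (v == p2.-1)) || ((u == p2.-1) && (v == 0%N)))%:R.

Lemma cabs_hatB (c d : int -> int -> R[i]) n (x : R) u v :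
  (u < p2)%N -> (v < p2)%N ->
  cabs (hat_e p2 c d n x u v - hat0_e c d n u v) = corner c n u v.
Proof.
move=> up vp; rewrite /hat_e /hat0_e /corner.
case: (boolP ((u == 0%N) && (v == p2.-1))) => h1 /=.
  do 3 (case: ifP => [?|_]; first lia).
  by rewrite subr0 cabsM cabs_expi mul1r mulr1.
case: (boolP ((u == p2.-1) && (v == 0%N))) => h2 /=.
  do 3 (case: ifP => [?|_]; first lia).
  by rewrite subr0 ?conjE cabsM !cabs_conj cabs_expi mul1r mulr1.
by rewrite mulr0; do 3 (case: ifP => _; first by rewrite subrr cabs0); rewrite subrr cabs0.
Qed.

Lemma hat_e_conj n (x : R) u v : (u < p2)%N -> (v < p2)%N ->
  (hat_e p2 b0 b1 n x v u)^* = hat_e p2 b0 b1 n x u v.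
Proof.
move=> up vp; rewrite /hat_e; repeat (case: ifP => ?);
  try lia; rewrite ?conjE ?conjc0 ?conjcM ?conjcK ?conj_b1 //; try (congr (b1 _ _); lia).
Qed.

Lemma hat0_e_conj n u v :
  (hat0_e b0 b1 n v u)^* = hat0_e b0 b1 n u v.
Proof.
rewrite /hat0_e; repeat (case: ifP => ?);
  try lia; rewrite ?conjE ?conjc0 ?conjcK ?conj_b1 //; try (congr (b1 _ _); lia).
Qed.

Let divp (i : 'I_(p1 * p2)) : (i %/ p2 < p1)%N.
Proof. by rewrite ltn_divLR //; lia. Qed.

Let modp (i : 'I_(p1 * p2)) : (i %% p2 < p2)%N.
Proof. by rewrite ltn_mod; lia. Qed.

Lemma adj_Jmat (x y : R) : adj (Jmat p1 p2 a0 a1 b0 b1 x y) = Jmat p1 p2 a0 a1 b0 b1 x y.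
Proof.
apply/matrixP => i j; rewrite !mxE /=.
have := divp i; have := divp j; have := modp i; have := modp j.
move: (i %/ p2)%N (j %/ p2)%N (i %% p2)%N (j %% p2)%N => N K u v hv hu hK hN.
case: (eqVneq N K) => [->|NK]; first by rewrite hat_e_conj.
repeat (case: ifP => ?); try lia; rewrite ?conjE ?conjc0 ?conjcM ?conjcK //.
Qed.

Lemma adj_J0mat : adj (J0mat p1 p2 a0 a1 b0 b1) = J0mat p1 p2 a0 a1 b0 b1.
Proof.
apply/matrixP => i j; rewrite !mxE /=.
move: (i %/ p2)%N (j %/ p2)%N (i %% p2)%N (j %% p2)%N => N K u v.
case: (eqVneq N K) => [->|NK]; first by rewrite hat0_e_conj.
repeat (case: ifP => ?); try lia; rewrite ?conjE ?conjc0 ?conjcK //.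
Qed.

Lemma CmatE : Cmat p1 p2 a0 a1 b0 b1 =
  diagC (fun k => ccoef p1 p2 a0 a1 b0 b1 (k %/ p2)%N (k %% p2)%N).
Proof.
apply/matrixP => i j; rewrite !mxE; case: eqP => [->|_]; first by rewrite mulr1n.
by rewrite mulr0n.
Qed.

Lemma corner_sum (c : int -> int -> R[i]) n v : (v < p2)%N ->
  \sum_(u < p2) corner c n u v = if (v == 0%N) || (v == p2.-1) then cabs (c n p2%:Z) else 0.
Proof.
move=> vp; rewrite /corner -mulr_sumr.
have -> : \sum_(u < p2) ((((u : nat) == 0%N) && (v == p2.-1)) ||
    (((u : nat) == p2.-1) && (v == 0%N)))%:R =
  \sum_(u < p2) (if (u : nat) == (if v == 0%N then p2.-1 else 0%N) then
     (((v == 0%N) || (v == p2.-1))%:R : R) else 0).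
  apply: eq_bigr => u _; have := ltn_ord u.
  move: (nat_of_ord u) => k kp; case: ifP => h.
    by congr (_%:R); congr nat_of_bool; move: h; case: ifP; lia.
  by rewrite (_ : _ || _ = false) //; move: h; case: ifP; lia.
rewrite (sum_ord_pick _ _ (fun=> (((v == 0%N) || (v == p2.-1))%:R : R))).
have -> : ((if v == 0%N then p2.-1 else 0%N) < p2)%N by case: ifP; lia.
by case: ifP => _; rewrite ?mulr1 ?mulr0.
Qed.

Lemma cornerC (c : int -> int -> R[i]) n u v : corner c n u v = corner c n v u.
Proof. by rewrite /corner; congr (_ * (nat_of_bool _)%:R); lia. Qed.

(** A column has entries at [v] and at its cyclic successor and predecessor. These three rows are
    distinct because [p2 >= 3], so the modulus splits as a sum of indicators, each easily summed
    over [u]. *)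
Lemma cabs_hat (c d : int -> int -> R[i]) n (x : R) u v :
  (u < p2)%N -> (v < p2)%N ->
  cabs (hat_e p2 c d n x u v) =
    (if u == v then cabs (d n v.+1%:Z) else 0) +
    (if u == (if v == p2.-1 then 0 else v.+1)%N then cabs (c n v.+1%:Z) else 0) +
    (if u == (if v == 0 then p2.-1 else v.-1)%N
     then cabs (c n (if v == 0 then p2 else v)%N%:Z) else 0).
Proof.
move=> up vp.
have : exists r, r = (if v == p2.-1 then 0 else v.+1)%N /\
    (v = p2.-1 /\ r = 0 \/ v < p2.-1 /\ r = v.+1)%N.
  by exists (if v == p2.-1 then 0 else v.+1)%N; split=> //; case: ifP; lia.
case=> r [<- hr].
have : exists r2 r3, [/\ r2 = (if v == 0 then p2.-1 else v.-1)%N,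
    r3 = (if v == 0 then p2 else v)%N &
    (v = 0 /\ r2 = p2.-1 /\ r3 = p2 \/ 0 < v /\ r2 = v.-1 /\ r3 = v)%N].
  exists (if v == 0 then p2.-1 else v.-1)%N, (if v == 0 then p2 else v)%N; split=> //.
  by case: ifP; lia.
case=> r2 [r3 [<- <- hr2]]; rewrite /hat_e.
repeat (case: ifP => ?; try lia);
  rewrite ?conjE ?cabsM ?cabs_conj ?cabs_expi ?cabs0 ?mul1r ?addr0 ?add0r //;
  congr (cabs (_ _ _)); lia.
Qed.

Lemma hat_sum (x : R) v : (v < p2)%N ->
  \sum_(u < p2) cabs (hat_e p2 a0 a1 p1%:Z x u v) = dcoef p1 p2 a0 a1 v.+1.
Proof.
move=> vp; rewrite (eq_bigr _ (fun (u : 'I_p2) _ => cabs_hat a0 a1 _ _ (ltn_ord u) vp)).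
rewrite !big_split /= (sum_ord_pick _ _ (fun=> cabs (a1 p1 v.+1))).
rewrite (sum_ord_pick _ _ (fun=> cabs (a0 p1 v.+1))) (sum_ord_pick _ _ (fun=> cabs _)) vp.
have -> : ((if v == p2.-1 then 0 else v.+1) < p2)%N by case: ifP; lia.
have -> : ((if v == 0 then p2.-1 else v.-1) < p2)%N by case: ifP; lia.
by rewrite /dcoef eqSS /=; case: ifP.
Qed.

Lemma hat_sumr (x : R) v : (v < p2)%N ->
  \sum_(u < p2) cabs (hat_e p2 a0 a1 p1%:Z x v u) = dcoef p1 p2 a0 a1 v.+1.
Proof.
move=> vp; rewrite -(hat_sum x vp); apply: eq_bigr => u _; have up := ltn_ord u.
rewrite /hat_e; repeat (case: ifP => ?); try lia;
  rewrite ?conjE ?cabsM ?cabs_conj ?cabs_expi //; congr (cabs (a1 _ _)); lia.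
Qed.

Lemma perturbation_sum (x y : R) (k : 'I_(p1 * p2)) :
  \sum_j cabs ((Jmat p1 p2 a0 a1 b0 b1 x y - J0mat p1 p2 a0 a1 b0 b1) j k) <=
  ccoef p1 p2 a0 a1 b0 b1 (k %/ p2)%N (k %% p2)%N.
Proof.
have := divp k; have := modp k; set K := (k %/ p2)%N; set v := (k %% p2)%N => hv hK.
(* Column [k] meets five block positions: diagonal, below, above, and the corners [(1, p1)] and
   [(p1, 1)], where the whole block counts since [J_0] is zero there. They do not overlap as
   [p1 >= 3]. The test [K == 0] is needed because the predecessor of [0] is [0]. *)
pose f N u : R :=
  (if N == K then corner b0 N.+1%:Z u v else 0) +
  (if N == K.+1 then corner a0 K.+1%:Z u v else 0) +
  (if N == K.-1 then (if K == 0%N then 0 else corner a0 K%:Z u v) else 0) +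
  (if N == 0%N then (if K == p1.-1 then cabs (hat_e p2 a0 a1 p1%:Z x u v) else 0) else 0) +
  (if N == p1.-1 then (if K == 0%N then cabs (hat_e p2 a0 a1 p1%:Z x v u) else 0) else 0).
rewrite (eq_bigr (fun j : 'I__ => f (j %/ p2)%N (j %% p2)%N)); last first.
  move=> j _; rewrite !mxE /= -/K -/v.
  have := divp j; have := modp j; move: (j %/ p2)%N (j %% p2)%N => N u hu hN.
  rewrite /f; case: (eqVneq N K) => [->|NK].
    by rewrite cabs_hatB //; repeat (case: ifP => ?; try lia); rewrite !addr0.
  case: (eqVneq N K.+1) => [->|NK1].
    by rewrite cabs_hatB //; repeat (case: ifP => ?; try lia); rewrite ?addr0 ?add0r.
  case: (eqVneq K N.+1) => [->|KN1].
    rewrite -rmorphB cabs_conj cabs_hatB // cornerC.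
    by repeat (case: ifP => ?; try lia); rewrite ?addr0 ?add0r.
  rewrite subr0; case: ifP => h1.
    rewrite cabsM cabs_expi mul1r.
    by repeat (case: ifP => ?; try lia); rewrite ?addr0 ?add0r.
  case: ifP => h2.
    rewrite ?conjE cabsM !cabs_conj cabs_expi mul1r.
    by repeat (case: ifP => ?; try lia); rewrite ?addr0 ?add0r.
  by rewrite cabs0; repeat (case: ifP => ?; try lia); rewrite !addr0.
rewrite (sum_ord_mul p1 p2 f).
have fE (N : 'I_p1) : \sum_(u < p2) f N u =
  (if (N : nat) == K then \sum_(u < p2) corner b0 N.+1%:Z u v else 0) +
  (if (N : nat) == K.+1 then \sum_(u < p2) corner a0 K.+1%:Z u v else 0) +
  (if (N : nat) == K.-1 then (if K == 0%N then 0 else \sum_(u < p2) corner a0 K%:Z u v) else 0) +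
  (if (N : nat) == 0%N then
     (if K == p1.-1 then \sum_(u < p2) cabs (hat_e p2 a0 a1 p1%:Z x u v) else 0) else 0) +
  (if (N : nat) == p1.-1 then
     (if K == 0%N then \sum_(u < p2) cabs (hat_e p2 a0 a1 p1%:Z x v u) else 0) else 0).
  by rewrite /f !big_split /=; congr (_ + _ + _ + _ + _); repeat case: ifP => _; rewrite ?big1_eq.
rewrite (eq_bigr _ (fun N _ => fE N)) !big_split /=.
rewrite (sum_ord_pick _ _ (fun N => \sum_(u < p2) corner b0 N.+1%:Z u v)).
rewrite 4!(sum_ord_pick _ _ (fun=> _)) !corner_sum // hat_sum // hat_sumr // hK.
rewrite /ccoef.
have -> : (K.-1 < p1)%N by lia.
have -> : (0 < p1)%N by lia.
have -> : (p1.-1 < p1)%N by lia.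
case: (eqVneq K 0%N) => [K0|K0].
  rewrite K0 /=; have -> : (1 < p1)%N by lia.
  have -> : (0 == p1.-1)%N = false by lia.
  by case: ifP => _; rewrite ?addr0 ?add0r.
rewrite eqSS (negbTE K0); case: (eqVneq K p1.-1) => [Kp|Kp].
  have -> : K.+1 == p1 by lia.
  have -> : (K.+1 < p1)%N = false by lia.
  have -> : K.+1%:Z = p1%:Z by lia.
  have -> : K%:Z = (p1.-1)%:Z by lia.
  by case: ifP => _; rewrite ?addr0 ?add0r.
have -> : K.+1 == p1 = false by lia.
have -> : (K.+1 < p1)%N by lia.
by case: ifP => _; rewrite !addr0.
Qed.

Lemma Jmat_eigs_bounds (x y : R) (s sm sp : seq R) k :
  sorted_eigs (Jmat p1 p2 a0 a1 b0 b1 x y) s ->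
  sorted_eigs (J0mat p1 p2 a0 a1 b0 b1 - Cmat p1 p2 a0 a1 b0 b1) sm ->
  sorted_eigs (J0mat p1 p2 a0 a1 b0 b1 + Cmat p1 p2 a0 a1 b0 b1) sp ->
  (k < p1 * p2)%N -> nth 0 sm k <= nth 0 s k <= nth 0 sp k.
Proof.
move=> es em ep kn.
have aC : adj (Cmat p1 p2 a0 a1 b0 b1) = Cmat p1 p2 a0 a1 b0 b1 by rewrite CmatE adj_diagC.
have aP : adj (Jmat p1 p2 a0 a1 b0 b1 x y - J0mat p1 p2 a0 a1 b0 b1) =
    Jmat p1 p2 a0 a1 b0 b1 x y - J0mat p1 p2 a0 a1 b0 b1.
  by rewrite adjB adj_Jmat adj_J0mat.
have form v := form_sandwich (gershgorin_form v aP (perturbation_sum x y)).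
move: form; rewrite -CmatE => form; apply/andP; split.
  apply: (sorted_eigs_le _ _ em es) => // [||v]; last by case: (form v).
    by rewrite adjB adj_J0mat aC.
  exact: adj_Jmat.
apply: (sorted_eigs_le _ _ es ep) => // [||v]; last by case: (form v).
  exact: adj_Jmat.
by rewrite adjD adj_J0mat aC.
Qed.

End MatrixBounds.

(** * The Jacobi operator on the lattice *)

Lemma lebesgue_measure_cover (R : realType) (n : nat) (s t : nat -> R) (S : set R) :
  (forall k, (k < n)%N -> s k <= t k) ->
  (forall l, S l -> exists2 k, (k < n)%N & s k <= l <= t k) ->
  (lebesgue_measure S <= (\sum_(k < n) (t k - s k))%:E)%E.
Proof.
move=> st cover.
pose A k : set R := `[s k, t k]%classic.
apply: (@le_trans _ _ (lebesgue_measure (\big[setU/set0]_(k < n) A k))).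
  (* Monotonicity is that of the outer measure, so it applies to the arbitrary set [S]. *)
  apply: le_mu_ext => l /cover[k kn lk].
  rewrite -(bigcup_mkord n A); by exists k.
apply: le_trans (Boole_inequality _ _) _; first by move=> i _; exact: measurable_itv.
rewrite -sumEFin; apply: lee_sum => k _.
have := st k (ltn_ord k) => h.
apply: le_trans (_ : lebesgue_measure (A k) <= _)%E; first exact: lexx.
rewrite /A lebesgue_measure_itv /= lte_fin.
by case: ifP => // _; rewrite lee_fin subr_ge0.
Qed.

Section Lattice.
Variable R : realType.
Local Notation C := R[i].

(** The extended sum is the supremum of its finite partial sums, so its finiteness is a uniform
    bound on them; this links [l2] to [l2_le]. *)
Lemma l2_finite_sums (f : int -> int -> C) :
  l2 f <-> exists M : R, forall t : seq (int * int), uniq t ->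
    \sum_(x <- t) cnorm2 (f x.1 x.2) <= M.
Proof.
pose g (x : int * int) : \bar R := (cnorm2 (f x.1 x.2))%:E.
have fsE (t : seq (int * int)) : uniq t ->
    \sum_(x \in [set` t]%classic) g x = (\sum_(x <- t) cnorm2 (f x.1 x.2))%:E.
  by move=> ut; rewrite -fsbig_seq // sumEFin.
rewrite /l2; split=> [fin|[M hM]].
  have hle t : uniq t -> ((\sum_(x <- t) cnorm2 (f x.1 x.2))%:E <=
      \esum_(k in [set: int * int]) g k)%E.
    move=> ut; apply: esum_ge; exists [set` t]%classic; last by rewrite fsE.
    by split=> //; apply: finite_seq.
  have g0 : (0 <= \esum_(k in [set: int * int]) g k)%E.
    by apply: esum_ge0 => x _; rewrite lee_fin cnorm2_ge0.
  have fnum : (\esum_(k in [set: int * int]) g k)%E \is a fin_num by rewrite ge0_fin_numE.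
  exists (fine (\esum_(k in [set: int * int]) g k)) => t ut.
  by rewrite -lee_fin fineK // hle.
apply: (@le_lt_trans _ _ M%:E); last exact: ltry.
apply: ge_ereal_sup => _ [A [finA _] <-].
have [t ut ->] : exists2 t : seq (int * int), uniq t & A = [set` t]%classic.
  have /finite_seqP[t ->] := finA.
  exists (undup t); first exact: undup_uniq.
  by apply/seteqP; split=> x /=; rewrite mem_undup.
by rewrite fsE // lee_fin hM.
Qed.

Lemma periodicMz (V : Type) (h : int -> V) (p : nat) :
  (forall z, h (z + p%:Z) = h z) -> forall z k : int, h (z + k * p%:Z) = h z.
Proof.
move=> hp z k; elim/int_rect: k => [|k IH|k IH]; first by rewrite mul0r addr0.
  by rewrite -[in LHS]addn1 PoszD mulrDl mul1r addrA hp.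
rewrite -(hp (z + _)) -IH; congr h; rewrite -addn1 PoszD; ring.
Qed.

(** Sliding the window by one trades its first term for an equal last one. The window sum thus has
    period [1] in [z]. *)
Lemma periodic_sum (h : int -> R) (p : nat) (z : int) :
  (forall z, h (z + p%:Z) = h z) ->
  \sum_(k < p) h (z + k%:Z) = \sum_(1 <= i < p.+1) h i%:Z.
Proof.
move=> hp; pose S z := \sum_(k < p) h (z + k%:Z).
have S1 y : S (y + 1) = S y.
  case: p hp @S => [|p] hp S; first by rewrite /S !big_ord0.
  rewrite /S big_ord_recr big_ord_recl /= addrC; congr (_ + _).
    by rewrite addr0 -(hp y); congr h; lia.
  by apply: eq_bigr => i _; congr h; rewrite /bump /=; lia.
have Sz y (k : int) : S (y + k * 1%:Z) = S y by apply: periodicMz.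
have -> : \sum_(k < p) h (z + k%:Z) = S (1 + (z - 1) * 1%:Z).
  by rewrite /S; apply: eq_bigr => k _; congr h; lia.
rewrite Sz /S big_add1 /= big_mkord; apply: eq_bigr => i _; congr h; lia.
Qed.

Lemma edge_sum (p q x y : nat) (g : nat -> nat -> R) : (x < p)%N -> (y < q)%N ->
  \sum_(a < p) \sum_(b < q) (if ((a : nat) == x) || ((b : nat) == y) then g a b else 0) =
  \sum_(b < q) g x b + \sum_(a < p) g a y - g x y.
Proof.
move=> xp yq.
have -> : \sum_(a < p) \sum_(b < q)
    (if ((a : nat) == x) || ((b : nat) == y) then g a b else 0) =
  \sum_(a < p) ((if (a : nat) == x then \sum_(b < q) g x b else 0) + g a y -
    (if (a : nat) == x then g x y else 0)).
  apply: eq_bigr => a _; case: eqP => [->|_] /=; first by rewrite addrK.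
  by rewrite (sum_ord_pick _ _ (g a)) yq add0r subr0.
rewrite sumrB big_split /= (sum_ord_pick _ _ (fun=> \sum_(b < q) g x b)).
by rewrite (sum_ord_pick _ _ (fun=> g x y)) xp.
Qed.

Lemma row_sum (p q x : nat) (g : nat -> nat -> R) : (x < p)%N ->
  \sum_(a < p) \sum_(b < q) (if (a : nat) == x then g a b else 0) = \sum_(b < q) g x b.
Proof.
move=> xp; rewrite (eq_bigr (fun a : 'I_p => if (a : nat) == x then \sum_(b < q) g a b else 0)).
  by rewrite (sum_ord_pick _ _ (fun a => \sum_(b < q) g a b)) xp.
by move=> a _; case: eqP => // _; rewrite big1.
Qed.

End Lattice.

Section Operator.
Variables (R : realType) (p1 p2 : nat) (a0 a1 b0 b1 : int -> int -> R[i]) (al be : int).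
Local Notation C := R[i].
Local Notation N := (p1 * p2)%N.
Hypotheses (p1_ge3 : (3 <= p1)%N) (p2_ge3 : (3 <= p2)%N).
Hypotheses (a0_per : periodic2 p1 p2 a0) (a1_per : periodic2 p1 p2 a1).
Hypotheses (b0_per : periodic2 p1 p2 b0) (b1_per : periodic2 p1 p2 b1).
Hypothesis b1_real : forall n m, complex.Im (b1 n m) = 0.

(* The lattice is tiled by translates of the cell
   [{al + 1, ..., al + p1} x {be + 1, ..., be + p2}]; [site c k] is the [k]-th point of
   the cell number [c]. *)
Definition site (c : int * int) (k : 'I_N) : int * int :=
  (al + 1 + c.1 * p1%:Z + (k %/ p2)%N%:Z, be + 1 + c.2 * p2%:Z + (k %% p2)%N%:Z).

(** Used both for lattice offsets between coupled sites and for offsets between coupled cells: a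
    step of length one leads at most to an adjacent cell. *)
Definition shifts : seq (int * int) :=
  [:: (-1, -1); (-1, 0); (-1, 1); (0, -1); (0, 0); (0, 1); (1, -1); (1, 0); (1, 1)].

Lemma mem_shifts d : (d \in shifts) = (-1 <= d.1 <= 1) && (-1 <= d.2 <= 1).
Proof. by case: d => x y; rewrite /shifts !inE !xpair_eqE /=; lia. Qed.

Let divp (k : 'I_N) : (k %/ p2 < p1)%N.
Proof. by rewrite ltn_divLR //; lia. Qed.

Let modp (k : 'I_N) : (k %% p2 < p2)%N.
Proof. by rewrite ltn_mod; lia. Qed.

Lemma site_inj c k c' k' : site c k = site c' k' -> c = c' /\ k = k'.
Proof.
case: c c' => [x y] [x' y'] [/= h1 h2].
have := divp k; have := divp k'; have := modp k; have := modp k'.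
have := divn_eq k p2; have := divn_eq k' p2.
move: (k %/ p2)%N (k %% p2)%N (k' %/ p2)%N (k' %% p2)%N h1 h2.
move=> u v u' v' h1 h2 ek' ek hv' hv hu' hu.
have ex : x = x' by nia.
have ey : y = y' by nia.
split; first by rewrite ex ey.
by apply: val_inj => /=; rewrite ek ek' ex ey in h1 h2 *; nia.
Qed.

Lemma site_surj z : exists ck, site ck.1 ck.2 = z.
Proof.
case: z => n m.
pose x := n - al - 1; pose y := m - be - 1.
have x0 := modz_ge0 x (_ : p1%:Z != 0); have y0 := modz_ge0 y (_ : p2%:Z != 0).
have x1 := ltz_pmod x (_ : 0 < p1%:Z); have y1 := ltz_pmod y (_ : 0 < p2%:Z).
have ex := divz_eq x p1%:Z; have ey := divz_eq y p2%:Z.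
pose u := `|(x %% p1%:Z)%Z|%N; pose v := `|(y %% p2%:Z)%Z|%N.
have hu : u%:Z = (x %% p1%:Z)%Z by rewrite gez0_abs // x0 //; lia.
have hv : v%:Z = (y %% p2%:Z)%Z by rewrite gez0_abs // y0 //; lia.
have up : (u < p1)%N by have := x1; lia.
have vp : (v < p2)%N by have := y1; lia.
have kp : (u * p2 + v < N)%N by nia.
exists ((x %/ p1%:Z)%Z, (y %/ p2%:Z)%Z, Ordinal kp).
rewrite /site /= divnMDl ?divn_small ?modnMDl ?modn_small //; last lia.
by congr pair; rewrite ?addn0 ?hu ?hv -/x -/y; move: ex ey; rewrite /x /y; lia.
Qed.

Definition cell0 (z : int * int) : bool :=
  (al + 1 <= z.1 < al + 1 + p1%:Z) && (be + 1 <= z.2 < be + 1 + p2%:Z).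

Lemma cell0_site d j : cell0 (site d j) = (d == 0).
Proof.
have := divp j; have := modp j; rewrite /cell0 /site /=.
case: d => x y; rewrite xpair_eqE /=; move: (j %/ p2)%N (j %% p2)%N => u v hv hu.
apply/idP/idP => [h|/andP[/eqP-> /eqP->]]; last lia.
have -> : x = 0 by nia.
have -> : y = 0 by nia.
by [].
Qed.

Lemma siteD c d j : site (c + d) j = site c j + (d.1 * p1%:Z, d.2 * p2%:Z).
Proof. by rewrite /site /=; congr pair; rewrite /=; ring. Qed.

Lemma site_sub c d j k : site (c + d) j - site c k = site d j - site 0 k.
Proof. by rewrite /site /=; congr pair; rewrite /=; ring. Qed.

Lemma site_neighbour k e : e \in shifts ->
  exists2 dj, dj.1 \in shifts & site dj.1 dj.2 = site 0 k + e.
Proof.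
rewrite mem_shifts => he; have [[d j] /= hd] := site_surj (site 0 k + e).
exists (d, j) => //=; rewrite mem_shifts; move: he hd; rewrite /site.
have := divp k; have := divp j; have := modp k; have := modp j.
case: d e => x y [e1 e2] /=.
move: (k %/ p2)%N (k %% p2)%N (j %/ p2)%N (j %% p2)%N => u v u' v' hv' hv hu' hu he [h1 h2].
by apply/andP; split; nia.
Qed.

(** Every neighbour of site [k] lies in exactly one place of one adjacent cell, so a sum over cells
    and positions becomes a sum over lattice offsets. *)
Lemma shift_sum (V : nmodType) (psi : int * int -> V) k :
  (forall e, e \notin shifts -> psi e = 0) ->
  \sum_(d <- shifts) \sum_j psi (site d j - site 0 k) = \sum_(e <- shifts) psi e.
Proof.
move=> psi0.
pose t := [seq site d j - site 0 k | d <- shifts, j <- enum 'I_N].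
have -> : \sum_(d <- shifts) \sum_j psi (site d j - site 0 k) = \sum_(e <- t) psi e.
  by rewrite /t big_allpairs_dep; apply: eq_bigr => d _; rewrite big_enum.
apply: sum_uniq_eq => // [|e _ /psi0 //|e eD].
  apply: allpairs_uniq; rewrite ?enum_uniq // => -[d j] [d' j'] _ _ /= /addIr /site_inj.
  by case=> -> ->.
have [[d j] /= dD hd] := site_neighbour k eD => /negP[].
apply/allpairsP; exists (d, j); split; rewrite ?mem_enum //=.
by rewrite hd addrC addKr.
Qed.

(** * Coefficients and cell matrices of the Jacobi operator *)

Definition tri_coef (c d : int -> int -> C) (n m e : int) : C :=
  if e == -1 then c n (m - 1) else if e == 0 then d n m else if e == 1 then conjc (c n m) else 0.

(** The weight of [f (z + e)] in the value of the operator at [z]. The branch [e.1 == -1] is a row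
    of [A_{n-1}^*]: the off-diagonal part of [A_{n-1}] is self-adjoint, so only [a1] is
    conjugated. *)
Definition coef (z e : int * int) : C :=
  if e.1 == 1 then tri_coef a0 a1 z.1 z.2 e.2
  else if e.1 == 0 then tri_coef b0 b1 z.1 z.2 e.2
  else if e.1 == -1 then tri_coef a0 (fun n m => conjc (a1 n m)) (z.1 - 1) z.2 e.2
  else 0.

Lemma coef0 z e : e \notin shifts -> coef z e = 0.
Proof.
rewrite mem_shifts /coef /tri_coef; case: e => x y /= h.
by repeat (case: ifP => ?; try lia).
Qed.

Lemma Jop_coef f n m : Jop a0 a1 b0 b1 f n m =
  \sum_(e <- shifts) f (n + e.1) (m + e.2) * coef (n, m) e.
Proof.
rewrite /shifts !big_cons big_nil /coef /tri_coef /= !addr0 /Jop /tri_op /tri_op_adj ?conjE.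
ring.
Qed.

(** Self-adjointness of the operator, read on its coefficients; the case [e = 0] rests on the
    reality of [b1]. *)
Lemma coef_conj z e : conjc (coef (z + e) (- e)) = coef z e.
Proof.
case: z e => [n m] [x y]; rewrite /coef /tri_coef /=.
case: (eqVneq x 1) => [->|x1].
  rewrite /=; case: (eqVneq y (-1)) => [->|y1]; first by rewrite /= conjcK addrK.
  case: (eqVneq y 0) => [->|y0]; first by rewrite /= conjcK addrK addr0.
  case: (eqVneq y 1) => [->|y1']; first by rewrite /= !addrK.
  by repeat (case: ifP => ?; try lia); rewrite conjc0.
case: (eqVneq x 0) => [->|x0].
  rewrite /=; case: (eqVneq y (-1)) => [->|y1]; first by rewrite /= conjcK addr0.
  case: (eqVneq y 0) => [->|y0]; first by rewrite /= conj_b1 // !addr0.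
  case: (eqVneq y 1) => [->|y1']; first by rewrite /= addrK addr0.
  by repeat (case: ifP => ?; try lia); rewrite conjc0.
case: (eqVneq x (-1)) => [->|x1'].
  rewrite /=; case: (eqVneq y (-1)) => [->|y1]; first by rewrite /= conjcK.
  case: (eqVneq y 0) => [->|y0]; first by rewrite /= addr0.
  case: (eqVneq y 1) => [->|y1']; first by rewrite /= addrK.
  by repeat (case: ifP => ?; try lia); rewrite conjc0.
by repeat (case: ifP => ?; try lia); rewrite conjc0.
Qed.

Lemma periodic2Mz (c : int -> int -> C) n m x y : periodic2 p1 p2 c ->
  c (n + x * p1%:Z) (m + y * p2%:Z) = c n m.
Proof.
move=> cper.
rewrite (periodicMz (h := fun n => c n (m + y * p2%:Z))); last first.
  by move=> z; case: (cper z (m + y * p2%:Z)).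
by rewrite (periodicMz (h := c n)) // => z; case: (cper n z).
Qed.

Lemma coef_per z c e : coef (z + (c.1 * p1%:Z, c.2 * p2%:Z)) e = coef z e.
Proof.
case: z c => [n m] [x y]; rewrite /coef /tri_coef /=.
have -> : n + x * p1%:Z - 1 = n - 1 + x * p1%:Z by ring.
have -> : m + y * p2%:Z - 1 = m - 1 + y * p2%:Z by ring.
by rewrite !periodic2Mz.
Qed.

Lemma coef_site c k e : coef (site c k) e = coef (site 0 k) e.
Proof. by rewrite -[c]add0r siteD coef_per. Qed.

(* Matrices act on row vectors: entry [(j, k)] is the weight of site [j] of the cell
   [c + d] in the value of the operator at site [k] of the cell [c]. *)
Definition cell_mx (d : int * int) : 'M[C]_N :=
  \matrix_(j, k) coef (site 0 k) (site d j - site 0 k).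

Lemma adj_cell_mx d : adj (cell_mx d) = cell_mx (- d).
Proof.
apply/matrixP => j k; rewrite !mxE -[RHS]coef_conj; congr conjc.
have -> : site 0 k + (site (- d) j - site 0 k) = site (- d) j by rewrite addrC subrK.
rewrite coef_site; congr (coef _ _).
by rewrite opprB -(site_sub (- d) d k j) addNr.
Qed.

Lemma cell_mx0 d : d \notin shifts -> cell_mx d = 0.
Proof.
move=> hd; apply/matrixP => j k; rewrite !mxE coef0 //.
move: hd; rewrite !mem_shifts /site; have := divp k; have := divp j; have := modp k; have := modp j.
case: d => x y /=; move: (k %/ p2)%N (k %% p2)%N (j %/ p2)%N (j %% p2)%N => u v u' v' hv' hv hu' hu.
by apply: contra => /andP[h1 h2]; apply/andP; split; nia.
Qed.

(** * Total weight of the couplings leaving a cell *)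

Definition leak (k : 'I_N) : R := \sum_(d <- shifts | d != 0) \sum_j cabs (cell_mx d j k).

Lemma leakE k : leak k =
  \sum_(e <- shifts) if cell0 (site 0 k + e) then 0 else cabs (coef (site 0 k) e).
Proof.
rewrite -(shift_sum k); last by move=> e /coef0 ->; rewrite cabs0 if_same.
rewrite /leak big_mkcond; apply: eq_bigr => d _; case: eqP => [->|/eqP d0] /=.
  by rewrite big1 // => j _; rewrite addrC subrK cell0_site eqxx.
by apply: eq_bigr => j _; rewrite addrC subrK cell0_site (negbTE d0) !mxE.
Qed.

Let st (u v : nat) : int * int := (al + 1 + u%:Z, be + 1 + v%:Z).
Let sg (i : bool) : int := if i then -1 else 1.
Let G (e : int * int) (u v : nat) : R :=
  if cell0 (st u v + e) then 0 else cabs (coef (st u v) e).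

Lemma periodic_sum_fst (c : int -> int -> C) (x z : int) : periodic2 p1 p2 c ->
  \sum_(u < p1) cabs (c (z + u%:Z) x) = \sum_(1 <= n < p1.+1) cabs (c n%:Z x).
Proof.
move=> cper; apply: (periodic_sum (h := fun n => cabs (c n x))) => n.
by case: (cper n x) => ->.
Qed.

Lemma periodic_sum_snd (c : int -> int -> C) (x z : int) : periodic2 p1 p2 c ->
  \sum_(v < p2) cabs (c x (z + v%:Z)) = \sum_(1 <= m < p2.+1) cabs (c x m%:Z).
Proof.
move=> cper; apply: (periodic_sum (h := fun m => cabs (c x m))) => m.
by case: (cper x m) => _ ->.
Qed.

Let xi (i : bool) : nat := if i then 0%N else p1.-1.
Let yj (j : bool) : nat := if j then 0%N else p2.-1.

Let xi_lt i : (xi i < p1)%N. Proof. by case: i; rewrite /xi; lia. Qed.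
Let yj_lt j : (yj j < p2)%N. Proof. by case: j; rewrite /yj; lia. Qed.

(** A coefficient crossing the boundary is indexed by its lower end: [al] for a step back from the
    first row, [al + p1] for a step out of the last row. Periodicity identifies the two. *)
Let fst_edge (c : int -> int -> C) (i : bool) m : periodic2 p1 p2 c ->
  c (al + 1 + (xi i)%:Z - i%:Z) m = c al m.
Proof.
move=> cper; case: i; rewrite /xi /=; first by congr c; lia.
by case: (cper al m) => <- _; congr c; lia.
Qed.

Let snd_edge (c : int -> int -> C) (j : bool) n : periodic2 p1 p2 c ->
  c n (be + 1 + (yj j)%:Z - j%:Z) = c n be.
Proof.
move=> cper; case: j; rewrite /yj /=; first by congr c; lia.
by case: (cper n be) => _ <-; congr c; lia.
Qed.

(** A diagonal step leaves the cell exactly from one boundary row and one boundary column. Their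
    common corner is counted twice, hence the subtracted term. *)
Lemma leak_diagonal (i j : bool) :
  \sum_(u < p1) \sum_(v < p2) G (sg i, sg j) u v =
  \sum_(1 <= m < p2.+1) cabs (a0 al m%:Z) + \sum_(1 <= n < p1.+1) cabs (a0 n%:Z be)
  - cabs (a0 al be).
Proof.
pose g u v := cabs (a0 (al + 1 + u%:Z - i%:Z) (be + 1 + v%:Z - j%:Z)).
rewrite (eq_bigr (fun u : 'I_p1 => \sum_(v < p2)
    (if ((u : nat) == xi i) || ((v : nat) == yj j) then g u v else 0))); last first.
  move=> u _; apply: eq_bigr => v _; have := ltn_ord u; have := ltn_ord v.
  rewrite /G /cell0 /st /xi /yj; move: (nat_of_ord u) (nat_of_ord v) => {}u {}v hv hu /=.
  have -> : cabs (coef (al + 1 + u%:Z, be + 1 + v%:Z) (sg i, sg j)) = g u v.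
    by rewrite /g {g} /coef /tri_coef; case: i; case: j; rewrite /= ?cabs_conj ?subr0.
  move: (g u v) => {g} h.
  by case: i; case: j; rewrite /sg /=; case: ifP => ?; case: ifP => ? //; lia.
rewrite edge_sum // /g fst_edge // snd_edge //; congr (_ + _ - _).
  rewrite -(periodic_sum_snd al (be + 1 - j%:Z) a0_per); apply: eq_bigr => v _.
  by rewrite fst_edge //; congr (cabs (a0 _ _)); ring.
rewrite -(periodic_sum_fst be (al + 1 - i%:Z) a0_per); apply: eq_bigr => u _.
by rewrite snd_edge //; congr (cabs (a0 _ _)); ring.
Qed.

Lemma leak_fst (i : bool) :
  \sum_(u < p1) \sum_(v < p2) G (sg i, 0) u v = \sum_(1 <= m < p2.+1) cabs (a1 al m%:Z).
Proof.
pose g u v := cabs (a1 (al + 1 + u%:Z - i%:Z) (be + 1 + v%:Z)).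
rewrite (eq_bigr (fun u : 'I_p1 => \sum_(v < p2)
    (if (u : nat) == xi i then g u v else 0))); last first.
  move=> u _; apply: eq_bigr => v _; have := ltn_ord u; have := ltn_ord v.
  rewrite /G /cell0 /st /xi; move: (nat_of_ord u) (nat_of_ord v) => {}u {}v hv hu /=.
  have -> : cabs (coef (al + 1 + u%:Z, be + 1 + v%:Z) (sg i, 0)) = g u v.
    by rewrite /g {g} /coef /tri_coef; case: i; rewrite /= ?cabs_conj ?subr0.
  move: (g u v) => {g} h.
  by case: i; rewrite /sg /=; case: ifP => ?; case: ifP => ? //; lia.
rewrite row_sum // -(periodic_sum_snd al (be + 1) a1_per); apply: eq_bigr => v _.
by rewrite /g fst_edge.
Qed.

Lemma leak_snd (j : bool) :
  \sum_(u < p1) \sum_(v < p2) G (0, sg j) u v = \sum_(1 <= n < p1.+1) cabs (b0 n%:Z be).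
Proof.
pose g v u := cabs (b0 (al + 1 + u%:Z) (be + 1 + v%:Z - j%:Z)).
rewrite exchange_big /= (eq_bigr (fun v : 'I_p2 => \sum_(u < p1)
    (if (v : nat) == yj j then g v u else 0))); last first.
  move=> v _; apply: eq_bigr => u _; have := ltn_ord u; have := ltn_ord v.
  rewrite /G /cell0 /st /yj; move: (nat_of_ord u) (nat_of_ord v) => {}u {}v hv hu /=.
  have -> : cabs (coef (al + 1 + u%:Z, be + 1 + v%:Z) (0, sg j)) = g v u.
    by rewrite /g {g} /coef /tri_coef; case: j; rewrite /= ?cabs_conj ?subr0.
  move: (g v u) => {g} h.
  by case: j; rewrite /sg /=; case: ifP => ?; case: ifP => ? //; lia.
rewrite row_sum // -(periodic_sum_fst be (al + 1) b0_per); apply: eq_bigr => u _.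
by rewrite /g snd_edge.
Qed.

(** Four diagonal directions and two along each axis, doubled, give the coefficients [8] and [4] of
    [rbound]. *)
Lemma leak_sum : 2 * \sum_k leak k = rbound p1 p2 a0 a1 b0 al be.
Proof.
have -> : \sum_k leak k = \sum_(e <- shifts) \sum_(u < p1) \sum_(v < p2) G e u v.
  under eq_bigr do rewrite leakE; rewrite exchange_big /=; apply: eq_bigr => e _.
  rewrite -(sum_ord_mul p1 p2 (G e)); apply: eq_bigr => k _.
  have -> : site 0 k = st (k %/ p2) (k %% p2) by rewrite /site /st /= !mul0r !addr0.
  by [].
have G0 : \sum_(u < p1) \sum_(v < p2) G (0, 0) u v = 0.
  rewrite big1 // => u _; rewrite big1 // => v _; have := ltn_ord u; have := ltn_ord v.
  by rewrite /G /cell0 /st /= => hv hu; case: ifP => //; lia.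
rewrite /shifts !big_cons big_nil G0.
rewrite (leak_diagonal true true) (leak_diagonal true false).
rewrite (leak_diagonal false true) (leak_diagonal false false).
rewrite (leak_fst true) (leak_fst false) (leak_snd true) (leak_snd false) /rbound.
lra.
Qed.

(** * Passage to cell fields and the covering of the spectrum *)

Definition cell_field (f : int -> int -> C) (c : int * int) : 'rV[C]_N :=
  \row_k f (site c k).1 (site c k).2.

Lemma l2_cell_field f : l2 f <-> exists M, l2_le (cell_field f) M.
Proof.
have cE s : \sum_(c <- s) nrm2 (cell_field f c) =
    \sum_(x <- [seq site c k | c <- s, k <- enum 'I_N]) cnorm2 (f x.1 x.2).
  rewrite big_allpairs_dep; apply: eq_bigr => c _; rewrite big_enum /=.
  by apply: eq_bigr => k _; rewrite mxE.
have us s : uniq s -> uniq [seq site c k | c <- s, k <- enum 'I_N].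
  move=> us; apply: allpairs_uniq; rewrite ?enum_uniq // => -[c k] [c' k'] _ _ /= /site_inj.
  by case=> -> ->.
rewrite l2_finite_sums; split=> -[M hM]; exists M.
  by move=> s us'; rewrite cE; apply: hM; apply: us.
have [cell hcell] := choice site_surj.
move=> t ut; apply: le_trans (hM (undup [seq (cell z).1 | z <- t]) (undup_uniq _)).
rewrite cE; apply: sum_uniq_le => //; first exact/us/undup_uniq.
  by move=> x; apply: cnorm2_ge0.
move=> z zt /negP[]; apply/allpairsP; exists (cell z); rewrite mem_undup mem_enum hcell.
by split=> //; apply: (map_f (fun z => (cell z).1)).
Qed.

Definition cell_res (l : R) (d : int * int) : 'M[C]_N :=
  cell_mx d - (if d == 0 then l%:C%:M else 0).

Lemma block_toeplitz_cell l f c k :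
  block_toeplitz shifts (cell_res l) (cell_field f) c 0 k =
  Jop a0 a1 b0 b1 f (site c k).1 (site c k).2 - l%:C * f (site c k).1 (site c k).2.
Proof.
rewrite /block_toeplitz /cell_res; under eq_bigr do rewrite mulmxBr.
rewrite sumrB !mxE; congr (_ - _).
  rewrite summxE Jop_coef.
  rewrite -(shift_sum k (psi := fun e =>
    f ((site c k).1 + e.1) ((site c k).2 + e.2) * coef ((site c k).1, (site c k).2) e)).
    apply: eq_bigr => d _; rewrite mxE; apply: eq_bigr => j _; rewrite !mxE.
    rewrite -surjective_pairing coef_site -(site_sub c d j k).
    have h (x y : int * int) : x + (y - x) = y by rewrite addrC subrK.
    set x := site c k; set y := site (c + d) j.
    have -> : x.1 + (y - x).1 = y.1 := congr1 fst (h x y).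
    by have -> : x.2 + (y - x).2 = y.2 := congr1 snd (h x y).
  by move=> e /coef0 ->; rewrite mulr0.
rewrite (bigD1_seq (0 : int * int)) //= big1 ?addr0; last first.
  by move=> d /negbTE d0; rewrite d0 mulmx0.
by rewrite mul_mx_scalar !mxE.
Qed.

Lemma adj_cell_lower : adj (cell_mx 0 - diagC leak) = cell_mx 0 - diagC leak.
Proof. by rewrite adjB adj_cell_mx oppr0 adj_diagC. Qed.

Lemma adj_cell_upper : adj (cell_mx 0 + diagC leak) = cell_mx 0 + diagC leak.
Proof. by rewrite adjD adj_cell_mx oppr0 adj_diagC. Qed.

Lemma cell_lower_upper v :
  ip (v *m (cell_mx 0 - diagC leak)) v <= ip (v *m (cell_mx 0 + diagC leak)) v.
Proof.
have : 0 <= ip (v *m diagC leak) v.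
  rewrite ip_diagC; apply: sumr_ge0 => k _; rewrite mulr_ge0 ?cnorm2_ge0 //.
  by apply: sumr_ge0 => d _; apply: sumr_ge0 => j _; apply: cabs_ge0.
by rewrite mulmxBr mulmxDr !ipDl ipNl; lra.
Qed.

(** By contraposition: if [l] lies in no band, the projector of the gap makes the block Toeplitz
    form of the operator minus [l] invertible. Solutions are carried back to the lattice through the
    bijection between sites and pairs of a cell and a position. *)
Lemma spectrum_bands (s t : seq R) l :
  sorted_eigs (cell_mx 0 - diagC leak) s -> sorted_eigs (cell_mx 0 + diagC leak) t ->
  spectrum a0 a1 b0 b1 l -> exists2 k, (k < N)%N & nth 0 s k <= l <= nth 0 t k.
Proof.
move=> es et; apply: contraPP => none; apply; rewrite /spectrum /=.
have gap k : (k < N)%N -> ~~ (nth 0 s k <= l <= nth 0 t k).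
  by move=> kN; apply/negP => h; apply: none; exists k.
have [p pp [e e0 hp]] :=
  gap_projector adj_cell_lower adj_cell_upper es et cell_lower_upper gap.
have resZ (v : 'rV[C]_N) X : ip (v *m (cell_res l 0 + X)) v =
    ip (v *m (cell_mx 0 + X)) v - l * nrm2 v.
  rewrite /cell_res eqxx !(mulmxDr, mulmxN) !ipDl ipNl mul_mx_scalar ipZl ip_nrm2; ring.
have [|||k|||surj inj] := block_toeplitz_bijective (D := shifts) (m := cell_res l)
    (w := leak) (p := p) (c0 := e) _ _ _ _ pp e0 _ _.
- by [].
- move=> d dD; rewrite /cell_res cell_mx0 //; case: eqP => [d0|_]; last by rewrite subrr.
  by rewrite d0 mem_shifts in dD.
- move=> d; rewrite /cell_res adjB adj_cell_mx oppr_eq0; congr (_ - _).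
  case: eqP => _; last by apply/matrixP => i j; rewrite !mxE conjc0.
  apply/matrixP => i j; rewrite !mxE eq_sym; case: eqP => _.
    by rewrite !mulr1n conjc_real.
  by rewrite !mulr0n conjc0.
- rewrite le_eqVlt; apply/orP; left; apply/eqP; apply: eq_bigr => d d0; apply: eq_bigr => j _.
  by rewrite /cell_res (negbTE d0) subr0.
- by move=> v; rewrite resZ; case: (hp v).
- by move=> v; rewrite resZ; case: (hp v).
move=> g /l2_cell_field[M gM].
have [F [M' FM] hF] := surj _ _ gM.
have [cell hcell] := choice site_surj.
have cellK c k : cell (site c k) = (c, k).
  have := hcell (site c k); case: (cell _) => c' k' /= /site_inj[-> ->] //.
pose f n m := F (cell (n, m)).1 0 (cell (n, m)).2.
have fF : cell_field f = F.
  apply/funext => c; apply/rowP => k; rewrite mxE /f -surjective_pairing cellK //.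
exists f; split.
  split; first by apply/l2_cell_field; exists M'; rewrite fF.
  apply/funext => n; apply/funext => m; have := hcell (n, m).
  case: (cell (n, m)) => c k /= hck.
  have := block_toeplitz_cell l f c k; rewrite fF hF mxE hck /= => ->.
  by [].
move=> f' [/l2_cell_field[M2 fM2] hf'].
have d0 c : cell_field f' c - cell_field f c = 0.
  apply: (inj (fun c => cell_field f' c - cell_field f c) (2 * M2 + 2 * M')) => [r ur|c'].
    apply: le_trans (_ : \sum_(c <- r) (2 * nrm2 (cell_field f' c) + 2 * nrm2 (F c)) <= _).
      by apply: ler_sum => c' _; rewrite fF; apply: nrm2B_le2.
    by rewrite big_split /= -!mulr_sumr lerD // ler_wpM2l // ?fM2 ?FM.
  rewrite block_toeplitzB fF hF; apply/rowP => k; rewrite !mxE block_toeplitz_cell.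
  by rewrite -hf' subrr.
apply/funext => n; apply/funext => m.
have := hcell (n, m); case: (cell (n, m)) => c k /= hck.
have /eqP := d0 c; rewrite subr_eq0 => /eqP /rowP /(_ k).
by rewrite !mxE hck.
Qed.

Lemma sorted_eigs_trace n (A : 'M[C]_n) (s : seq R) : adj A = A -> sorted_eigs A s ->
  complex.Re (\tr A) = \sum_(k < n) nth 0 s k.
Proof.
move=> hA es; have [_ [P PP AE]] := sorted_eigs_diag hA es.
rewrite AE mxtrace_mulC mulmxA PP mul1mx /mxtrace Re_sum.
by apply: eq_bigr => k _; rewrite !mxE eqxx mulr1n.
Qed.

Lemma spectrum_measure :
  (lebesgue_measure (spectrum a0 a1 b0 b1) <= (rbound p1 p2 a0 a1 b0 al be)%:E)%E.
Proof.
have [s es] := sorted_eigs_exists adj_cell_lower.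
have [t et] := sorted_eigs_exists adj_cell_upper.
have st_le k : (k < N)%N -> nth 0 s k <= nth 0 t k.
  exact: sorted_eigs_le adj_cell_lower adj_cell_upper es et cell_lower_upper.
apply: le_trans (lebesgue_measure_cover st_le _) _.
  by move=> l; apply: spectrum_bands.
(* The band lengths add up to the difference of the two traces, in which [cell_mx 0] cancels and
   twice the trace of [diagC leak] remains. *)
rewrite lee_fin -leak_sum sumrB -(sorted_eigs_trace adj_cell_lower es).
rewrite -(sorted_eigs_trace adj_cell_upper et).
rewrite /mxtrace !Re_sum -sumrB mulr_sumr.
apply: ler_sum => k _; rewrite !mxE eqxx mulr1n.
by case: (coef _ _) => x y /=; lra.
Qed.

End Operator.

Theorem theorem1p1 (R : realType) (p1 p2 : nat) (a0 a1 b0 b1 : int -> int -> R[i]) :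
  (3 <= p1)%N -> (3 <= p2)%N ->
  periodic2 p1 p2 a0 -> periodic2 p1 p2 a1 ->
  periodic2 p1 p2 b0 -> periodic2 p1 p2 b1 ->
  (forall n m, complex.Im (b1 n m) = 0) ->
  (forall (x y : R), 0 <= x <= 2 * pi -> 0 <= y <= 2 * pi ->
     forall s sm sp : seq R,
       sorted_eigs (Jmat p1 p2 a0 a1 b0 b1 x y) s ->
       sorted_eigs (J0mat p1 p2 a0 a1 b0 b1 - Cmat p1 p2 a0 a1 b0 b1) sm ->
       sorted_eigs (J0mat p1 p2 a0 a1 b0 b1 + Cmat p1 p2 a0 a1 b0 b1) sp ->
       forall k, (k < p1 * p2)%N ->
         nth 0 sm k <= nth 0 s k <= nth 0 sp k)
  /\
  (forall al be : int,
     (lebesgue_measure (spectrum a0 a1 b0 b1) <= (rbound p1 p2 a0 a1 b0 al be)%:E)%E).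
Proof.
move=> p1_ge3 p2_ge3 a0_per a1_per b0_per b1_per b1_real; split.
  by move=> x y _ _ s sm sp es em ep k kN; apply: (Jmat_eigs_bounds _ _ _ es em ep kN).
by move=> al be; apply: spectrum_measure.
Qed.
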